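(* Let $\eta>0$ be a constant such that $\|B(u,v)\|_{\mathcal X}\le\eta\|u\|_{\mathcal X}\|v\|_{\mathcal X}$ for all $u,v\in\mathcal X=\mathcal C_w([0,\infty),\mathcal{PM}^2)$ (such a constant exists). Let $a\in[2,3)$. There exists $\varepsilon\in(0,1/(4\eta))$ such that for every $u_0\in\mathcal{PM}^2$ and every $F\in\mathcal C_w([0,\infty),\mathcal{PM})$ with $F(t)\in\mathcal{PM}^{a-2}$ for all $t>0$ and $$\|u_0\|_{\mathcal{PM}^2}+\|F\|_{\mathcal C_w([0,\infty),\mathcal{PM})}+\sup_{t>0}t^{a/2-1}\|F(t)\|_{\mathcal{PM}^{a-2}}<\varepsilon,$$ the unique solution $u\in\mathcal X$ of the Navier--Stokes problem corresponding to $(u_0,F)$ with $\|u\|_{\mathcal X}\le2\varepsilon$ satisfies $$\sup_{t>0}t^{a/2-1}\|u(t)\|_{\mathcal{PM}^a}\le2\varepsilon.$$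
   Context: The Fourier transform on $\mathbb{R}^3$ is $\widehat v(\xi)=(2\pi)^{-3/2}\int_{\mathbb{R}^3}e^{-ix\cdot\xi}v(x)\,dx$, extended to tempered distributions. For $a\ge0$, $\mathcal{PM}^a=\{v\in\mathcal S'(\mathbb{R}^3):\widehat v\in L^1_{loc}(\mathbb{R}^3),\ \|v\|_{\mathcal{PM}^a}=\operatorname{ess\,sup}_{\xi\in\mathbb{R}^3}|\xi|^a|\widehat v(\xi)|<\infty\}$, and $\mathcal{PM}=\mathcal{PM}^0$. The same notation is used for vector-valued $v=(v_1,v_2,v_3)$, with $|\widehat v(\xi)|$ the Euclidean norm. All data, forces and solutions are vector valued with three components. $\mathcal C_w([0,\infty),\mathcal{PM}^a)$ is the space of bounded functions $u:[0,\infty)\to\mathcal{PM}^a$ that are weakly continuous as distributions ($t\mapsto\langle u(t),\varphi\rangle$ is continuous for every Schwartz function $\varphi$), with norm $\sup_{t\ge0}\|u(t)\|_{\mathcal{PM}^a}$. $\mathbb{P}$ is the Leray projector, with matrix symbol $(\widehat{\mathbb{P}}(\xi))_{j,k}=\delta_{jk}-\xi_j\xi_k/|\xi|^2$. For $u,v\in\mathcal{PM}^2$, $\widehat{u_kv_j}=(2\pi)^{-3/2}\,\widehat u_k*\widehat v_j$, $u\otimes v$ is the matrix with entries $u_kv_j$, and $i\xi\cdot\widehat{(u\otimes v)}$ is the vector with $j$-th component $\sum_k i\xi_k\widehat{u_kv_j}$. The bilinear operator $B$ is defined by $\widehat{B(u,v)}(\xi,t)=-\int_0^te^{-(t-\tau)|\xi|^2}\widehat{\mathbb{P}}(\xi)\,i\xi\cdot\widehat{(u\otimes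 v)}(\xi,\tau)\,d\tau$. The Navier--Stokes problem is $u_t-\Delta u+(u\cdot\nabla)u+\nabla p=F$, $\nabla\cdot u=0$, $u(0)=u_0$ on $\mathbb{R}^3$. By a solution corresponding to $(u_0,F)$ we mean $u\in\mathcal C_w([0,\infty),\mathcal{PM}^2)$ such that for all $t\ge0$ $$\widehat u(\xi,t)=e^{-t|\xi|^2}\widehat u_0(\xi)-\int_0^te^{-(t-\tau)|\xi|^2}\widehat{\mathbb{P}}(\xi)\,i\xi\cdot\widehat{(u\otimes u)}(\xi,\tau)\,d\tau+\int_0^te^{-(t-\tau)|\xi|^2}\widehat{\mathbb{P}}(\xi)\widehat F(\xi,\tau)\,d\tau .$$ If $0<\varepsilon<1/(4\eta)$ and $\|u_0\|_{\mathcal{PM}^2}+\|F\|_{\mathcal C_w([0,\infty),\mathcal{PM})}<\varepsilon$, there is a unique solution $u$ with $\|u\|_{\mathcal X}\le2\varepsilon$. *)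

(* Defs.v *)
(* Built on MathComp and MathComp-Analysis, with complex numbers R[i] from
   mathcomp-real-closed. *)
From HB Require Import structures.
From mathcomp Require Import all_boot all_order all_algebra.
From mathcomp Require Import all_classical all_reals all_analysis.
From mathcomp Require Import ess_sup_inf complex.

Set Implicit Arguments.
Unset Strict Implicit.
Unset Printing Implicit Defensive.

Import Order.TTheory GRing.Theory Num.Theory.
Import numFieldNormedType.Exports.

Local Open Scope classical_set_scope.
Local Open Scope ring_scope.

(* R^3 is the iterated product R * R * R, which carries the product topology,
   the product (Borel) sigma-algebra and the product measure. *)
Notation space R := (R * R * R)%type.

(* The same type, seen with the sigma-algebra on which Lebesgue measure is
   declared in the library. *)
Notation mspace R :=
  (measurableTypeR R * measurableTypeR R * measurableTypeR R)%type.

(* A functional on complex-valued functions on R^3. Only its values on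
   Schwartz functions are meaningful; see [tempered]. *)
Notation functional R := ((space R -> R[i]) -> R[i]).

Notation vfunctional R := ('I_3 -> functional R).

Section Defs.
Variable R : realType.
Implicit Types (x xi z : space R) (phi f g : space R -> R[i]).
Implicit Types (T : functional R) (v : vfunctional R).

Definition leb3 : {measure set (mspace R) -> \bar R} :=
  ((@lebesgue_measure R \x @lebesgue_measure R) \x @lebesgue_measure R)%E.

Definition coord x (j : 'I_3) : R := [:: x.1.1; x.1.2; x.2]`_j.

Definition dot x xi : R := \sum_(j < 3) coord x j * coord xi j.

Definition enorm x : R := Num.sqrt (dot x x).

Definition basis (j : 'I_3) : space R :=
  ((j == 0%N :> nat)%:R, (j == 1%N :> nat)%:R, (j == 2%N :> nat)%:R).

Definition cmod (c : R[i]) : R := Num.sqrt (complex.Re c ^+ 2 + complex.Im c ^+ 2).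

Definition cvnorm (c : 'cV[R[i]]_3) : R := Num.sqrt (\sum_(j < 3) cmod (c j 0) ^+ 2).

Definition Cintegral d (T : measurableType d) (mu : {measure set T -> \bar R})
    (D : set T) (f : T -> R[i]) : R[i] :=
  ((\int[mu]_(y in D) complex.Re (f y))%R +i*
   (\int[mu]_(y in D) complex.Im (f y))%R)%C.

Definition Cmeasurable d (T : measurableType d) (D : set T) (f : T -> R[i]) :=
  measurable_fun D (fun y => complex.Re (f y)) /\
  measurable_fun D (fun y => complex.Im (f y)).

Definition partials (s : seq 'I_3) (h : space R -> R) : space R -> R :=
  foldr (fun j k => fun x => 'D_(basis j) k x) h s.

Definition smooth (h : space R -> R) :=
  forall s, continuous (partials s h) /\
            forall j x, derivable (partials s h) x (basis j).

Definition Csmooth phi :=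
  smooth (fun x => complex.Re (phi x)) /\ smooth (fun x => complex.Im (phi x)).

Definition seminorm_le (n : nat) (s : seq 'I_3) phi (M : R) := forall x,
  (1 + enorm x) ^+ n * `|partials s (fun y => complex.Re (phi y)) x| <= M /\
  (1 + enorm x) ^+ n * `|partials s (fun y => complex.Im (phi y)) x| <= M.

Definition schwartz phi :=
  Csmooth phi /\ forall n s, exists M, seminorm_le n s phi M.

Definition test_function phi :=
  Csmooth phi /\ exists r : R, forall x, r < enorm x -> phi x = 0.

Definition tempered T :=
  (forall (c : R[i]) phi psi, schwartz phi -> schwartz psi ->
     T (fun x => c * phi x + psi x) = c * T phi + T psi) /\
  (forall phi_ : nat -> space R -> R[i],
     (forall m, schwartz (phi_ m)) ->
     (forall n s (e : R), 0 < e -> \forall m \near \oo, seminorm_le n s (phi_ m) e) ->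
     (fun m => cmod (T (phi_ m))) @ \oo --> (0 : R)).

Definition fourier_cst : R := (2 * pi) `^ (- (3 / 2)).

Definition fourier phi : space R -> R[i] := fun xi =>
  (fourier_cst%:C)%C *
  Cintegral leb3 setT (fun x => (cos (dot x xi) -i* sin (dot x xi))%C * phi x).

Definition fourier_dist T : functional R := fun phi => T (fourier phi).

Definition L1loc f :=
  Cmeasurable (setT : set (mspace R)) f /\
  forall K : set (space R), compact K ->
    (\int[leb3]_(x in K) (cmod (f x))%:E < +oo)%E.

Definition represents T f :=
  L1loc f /\ forall phi, test_function phi ->
    T phi = Cintegral leb3 setT (fun x => f x * phi x).

(* The Fourier transform of T as a function: a chosen representative, unique
   almost everywhere, and 0 when no representative exists. *)
Definition hat T : space R -> R[i] :=
  xget (fun=> 0) [set f | represents (fourier_dist T) f].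

Definition vhat v : space R -> 'cV[R[i]]_3 := fun xi => \col_j hat (v j) xi.

(* Meaningful when each component of v has a locally integrable Fourier
   transform. *)
Definition PMnorm (a : R) v : \bar R :=
  ess_sup leb3 (fun xi => (enorm xi `^ a * cvnorm (vhat v xi))%:E).

Definition PM (a : R) v :=
  (forall j, tempered (v j) /\ exists f, represents (fourier_dist (v j)) f) /\
  (PMnorm a v < +oo)%E.

Definition Cwnorm (a : R) (u : R -> vfunctional R) : \bar R :=
  ereal_sup [set PMnorm a (u t) | t in [set t | 0 <= t]].

Definition Cw (a : R) (u : R -> vfunctional R) :=
  [/\ forall t, 0 <= t -> PM a (u t),
      (Cwnorm a u < +oo)%E &
      forall phi j, schwartz phi ->
        {within [set t | 0 <= t], continuous (fun t => complex.Re (u t j phi))} /\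
        {within [set t | 0 <= t], continuous (fun t => complex.Im (u t j phi))}].

Definition weighted_sup (b a : R) (u : R -> vfunctional R) : \bar R :=
  ereal_sup [set ((t `^ b)%:E * PMnorm a (u t))%E | t in [set t | 0 < t]].

(* g is the function (t, xi) |-> \hat u(xi, t). Each slice \hat u(., t) is only
   defined up to a null set depending on t, so time integrals at fixed xi refer
   to a version measurable in (t, xi); by Fubini they do not depend, up to a
   null set of xi, on which one. *)
Definition spacetime_hat (u : R -> vfunctional R) (g : R -> space R -> 'cV[R[i]]_3) :=
  (forall j, Cmeasurable [set p : measurableTypeR R * mspace R | (0 : R) <= p.1]
               (fun p => g p.1 p.2 j 0)) /\
  (forall t, 0 <= t -> {ae leb3, forall xi, g t xi = vhat (u t) xi}).

Definition heat (t : R) xi : R[i] := ((expR (- t * enorm xi ^+ 2))%:C)%C.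

Definition leray xi : 'M[R[i]]_3 :=
  \matrix_(j, k)
    (((j == k)%:R - coord xi j * coord xi k / enorm xi ^+ 2)%:C)%C.

Definition conv f g : space R -> R[i] := fun xi =>
  Cintegral leb3 setT (fun z => f (xi - z) * g z).

(* The vector i xi . (u (x) v)^ computed from the Fourier transforms U and V of
   u and v; the hypotheses on u and v make the convolutions converge. *)
Definition div_tensor_hat (U V : space R -> 'cV[R[i]]_3) xi : 'cV[R[i]]_3 :=
  \col_j \sum_(k < 3) 'i%C * ((coord xi k)%:C)%C *
    ((fourier_cst%:C)%C * conv (fun z => U z k 0) (fun z => V z j 0) xi).

Definition duhamel (h : R -> space R -> 'cV[R[i]]_3) (t : R) xi : 'cV[R[i]]_3 :=
  \col_j Cintegral (@lebesgue_measure R) [set` `[0, t]]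
    (fun tau => (heat (t - tau) xi *: (leray xi *m h tau xi)) j 0).

Definition Bhat (U V : R -> space R -> 'cV[R[i]]_3) (t : R) xi : 'cV[R[i]]_3 :=
  - duhamel (fun tau => div_tensor_hat (U tau) (V tau)) t xi.

(* w is the value B(u, v), which is determined by its Fourier transform. *)
Definition is_B (u v w : R -> vfunctional R) :=
  exists U V, [/\ spacetime_hat u U, spacetime_hat v V &
    forall t, 0 <= t -> {ae leb3, forall xi, vhat (w t) xi = Bhat U V t xi}].

Definition NS_solution (u0 : vfunctional R) (F u : R -> vfunctional R) :=
  Cw 2 u /\
  exists U Fh, [/\ spacetime_hat u U, spacetime_hat F Fh &
    forall t, 0 <= t -> {ae leb3, forall xi,
      vhat (u t) xi =
        heat t xi *: vhat u0 xi + Bhat U U t xi + duhamel Fh t xi}].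

(* The bound on ||B(u, v)||_X includes that B maps X * X into X = C_w PM^2. *)
Definition B_bound (eta : R) :=
  forall u v : R -> vfunctional R, Cw 2 u -> Cw 2 v ->
    exists w, [/\ Cw 2 w, is_B u v w &
      (Cwnorm 2 w <= eta%:E * Cwnorm 2 u * Cwnorm 2 v)%E].

End Defs.

(* Main.v *)
(* Put b = a/2 - 1, which lies in [0, 1/2), phi(t, xi) = t^-b |xi|^-a and
   psi(xi) = |xi|^-2; the claim is |u^(t)| <= 2 eps phi(t).  No fixed point is
   constructed: the decay is bootstrapped on the given solution from
   |u^(t)| <= 2 eps psi.

   The convolution of |.|^-p and |.|^-2 is at most C |.|^(1 - p) for 1 < p < 3,
   hence |u^| <= 2 eps phi + d psi and |u^| <= 2 eps psi together imply
   |B(u, u)^| <= 2 C eps (2 eps phi + d psi).  The linear terms are at most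
   eps phi / (1 - b), and 1 / (1 - b) < 2.  So for small eps the bound
   2 eps phi + d psi improves itself to 2 eps phi + (2 C eps) d psi, and
   iterating sends d to 0.

   The gap between 1 / (1 - b) and 2 leaves no room for lossy constants in the
   forcing term: there the Leray projector must be a contraction for the
   Euclidean norm, and Minkowski's integral inequality must have constant 1. *)

(* The weighted norm of u is not known to be finite in advance, so an inequality bounding it by
   itself would prove nothing. The term d psi supplies a finite starting point, at the price of a
   limit.

   The nonlinear term carries the small factor 2 C eps, so constants may be lost in C. This is used:
   its time integrand is not shown to be measurable, so the real and imaginary parts of each
   component are bounded separately. The forcing term has no small factor, but the transform of F
   has a version measurable in time and frequency, which gives the linearity of the integral that a
   sharp vector bound needs.

   Null sets follow the same division. Almost everywhere bounds on U at one time control its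
   convolutions at every xi <> 0, so the time integral can be taken at once. For the force, the
   exceptional frequencies depend on the time, and Tonelli's theorem is needed to exchange the two.

   The constant 1 / (1 - b) is the integral of s^(-b) over ]0, 1]; it is below 2 precisely because a
   < 3. *)
From HB Require Import structures.
From mathcomp Require Import all_boot all_order all_algebra.
From mathcomp Require Import all_classical all_reals all_analysis.
From mathcomp Require Import measurable_realfun ess_sup_inf complex.
From mathcomp Require Import ring lra.
(* After MathComp, whose vector library also has a notation [space]. *)
Require Import Defs.

Set Implicit Arguments.
Unset Strict Implicit.
Unset Printing Implicit Defensive.

Import Order.TTheory GRing.Theory Num.Theory.
Import numFieldNormedType.Exports.

Local Open Scope classical_set_scope.
Local Open Scope ring_scope.

(** * Lebesgue measure on R^3 and dyadic decompositions *)

(* The integral of a nonnegative function is a supremum over the simple functions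
   below it, so it is monotone even on non-measurable functions. *)
Lemma ge0_le_integral_nomeas d (T : measurableType d) (R : realType)
    (mu : {measure set T -> \bar R}) (D : set T) (f g : T -> \bar R) :
  (forall x, D x -> (0 <= f x)%E) -> (forall x, D x -> (f x <= g x)%E) ->
  (\int[mu]_(x in D) f x <= \int[mu]_(x in D) g x)%E.
Proof.
move=> f0 fg; rewrite integral_mkcond [leRHS]integral_mkcond.
have h1 x : (0 <= (f \_ D) x)%E by exact: erestrict_ge0.
have h2 x : (0 <= (g \_ D) x)%E.
  by apply: erestrict_ge0 => y Dy; exact: le_trans (f0 _ Dy) (fg _ Dy).
rewrite !ge0_integralTE//; apply: ereal_sup_le => _ [h /= hf <-].
exists h => // x; apply: le_trans (hf x) _; exact: lee_restrict.
Qed.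

Section Space.
Context {R : realType}.
Implicit Types (c xi z : space R) (r p : R).

Lemma le_coord_norm z (j : 'I_3) : `|coord z j| <= `|z|.
Proof.
case: z => [[x y] t]; rewrite !prod_normE/= /coord/= !le_max.
by case: j => -[|[|[|//]]] /= _; rewrite lexx ?orbT.
Qed.

Lemma space_norm_le z r :
  (`|z| <= r) = [&& `|z.1.1| <= r, `|z.1.2| <= r & `|z.2| <= r].
Proof. by rewrite !prod_normE/= !ge_max andbA. Qed.

(** The norm of the product type is the maximum norm, so its balls are boxes of explicit measure.
    This is why kernels are estimated in this norm before passing to [enorm]. *)
Lemma cubeE c r : [set z | `|c - z| <= r] =
  (`[c.1.1 - r, c.1.1 + r] `*` `[c.1.2 - r, c.1.2 + r]) `*`
  `[c.2 - r, c.2 + r].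
Proof.
have E (x y : R) : (`|x - y| <= r) = (y \in `[x - r, x + r]).
  by rewrite distrC ler_distl in_itv.
apply/seteqP; split => z /=; rewrite space_norm_le/= !E.
  by case/and3P.
by case=> -[-> ->] ->.
Qed.

Lemma measurable_cube c r :
  measurable ([set z | `|c - z| <= r] : set (mspace R)).
Proof. by rewrite cubeE; do !apply: measurableX. Qed.

Lemma leb3E (A B C : set (measurableTypeR R)) :
    measurable A -> measurable B -> measurable C ->
  (leb3 R ((A `*` B) `*` C) =
   lebesgue_measure A * lebesgue_measure B * lebesgue_measure C)%E.
Proof.
move=> mA mB mC; etransitivity.
  by apply: product_measure1E => //; exact: measurableX.
by congr (_ * _)%E; exact: product_measure1E.
Qed.

Lemma leb3_cube c r : 0 <= r ->
  leb3 R [set z | `|c - z| <= r] = ((2 * r) ^+ 3)%:E.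
Proof.
move=> r0; rewrite cubeE leb3E// !lebesgue_measure_itv/= !lte_fin -!EFinD.
have E (x : R) : (if x - r < x + r then (x + r - (x - r))%:E else 0%E)
    = (2 * r)%:E.
  case: ltP => [_|]; first by congr EFin; ring.
  by move=> h; have -> : r = 0; [lra|rewrite mulr0].
by rewrite !E -!EFinM !exprS expr0 mulr1 mulrA.
Qed.

Lemma leb3_setT_gt0 : (0 < leb3 R setT)%E.
Proof.
apply: (@lt_le_trans _ _ (leb3 R [set z | `|(0 : space R) - z| <= 1])).
  by rewrite leb3_cube// lte_fin mulr1.
by apply: le_measure; rewrite ?inE//; exact: measurable_cube.
Qed.

Lemma measurable_space_norm c :
  measurable_fun setT (fun z : mspace R => `|(c : space R) - z| : R).
Proof.
rewrite (_ : (fun _ => _) = (fun z : mspace R => Num.max (Num.max (`|c.1.1 - z.1.1|)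
  `|c.1.2 - z.1.2|) `|c.2 - z.2|)); last first.
  by apply/funext => z; rewrite !prod_normE.
apply: measurable_maxr; first apply: measurable_maxr.
- apply: measurableT_comp => //; apply: measurable_funB => //.
  by apply: measurableT_comp => //; exact: measurable_fst.
- apply: measurableT_comp => //; apply: measurable_funB => //.
  by apply: measurableT_comp => //; exact: measurable_fst.
- by apply: measurableT_comp => //; apply: measurable_funB => //; exact: measurable_snd.
Qed.

(** [h] lies below the sum over k of [w k] times the indicator of the cube of radius [rho k], and
    the k-th integral is at most C x^k. Cubes may stand for shells, since overlaps only increase the
    bound. *)
Lemma integral_dyadic_le c (h : space R -> R) (rho w : nat -> R) (C x : R) :
  0 <= x -> x < 1 -> (forall z, 0 <= h z) ->
  (forall k, 0 <= w k) -> (forall k, 0 <= rho k) ->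
  (forall k, w k * (2 * rho k) ^+ 3 <= C * x ^+ k) ->
  (forall z, 0 < h z -> exists k, h z <= w k /\ `|c - z| <= rho k) ->
  (\int[leb3 R]_z (h z)%:E <= (C / (1 - x))%:E)%E.
Proof.
move=> x0 x1 h0 w0 rho0 wrho hw.
pose g k z : \bar R := ((w k)%:E * (\1_[set z : space R | (`|c - z| <= rho k)%R] z)%:E)%E.
have g0 k z : (0 <= g k z)%E by rewrite mule_ge0// lee_fin.
apply: (@le_trans _ _ (\int[leb3 R]_z \sum_(k <oo) g k z)%E).
  apply: ge0_le_integral_nomeas => z _; first by rewrite lee_fin.
  have := h0 z; rewrite le_eqVlt => /predU1P[<-|/hw[k [hwk ck]]].
    exact: nneseries_ge0.
  rewrite (le_trans _ (nneseries_lim_ge k.+1 _))//.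
  rewrite big_nat_recr//= (le_trans _ (leeDr _ _))//; last exact: sume_ge0.
  by rewrite /g indicE mem_set// mule1 lee_fin.
rewrite integral_nneseries//; last first.
  move=> k; apply/measurable_EFinP; apply: measurable_funM => //.
  exact: measurable_indic (measurable_cube _ _).
apply: (@le_trans _ _ (\sum_(k <oo) (C * x ^+ k)%:E)%E).
  apply: lee_nneseries => [k _ _|k _]; first by apply: integral_ge0 => z _.
  rewrite ge0_integralZl//; last 2 first.
  - by apply/measurable_EFinP; exact: measurable_indic (measurable_cube _ _).
  - by rewrite lee_fin.
  rewrite integral_indic//; last exact: measurable_cube.
  by rewrite setIT leb3_cube// -EFinM lee_fin.
rewrite le_eqVlt; apply/orP; left; apply/eqP/cvg_lim => //.
have := @cvg_geometric_series R C x; rewrite ger0_norm// => /(_ x1) cg.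
under eq_fun do rewrite sumEFin.
exact: cvg_comp cg _.
Qed.

End Space.

Section Powers.
Context {R : realType}.
Implicit Types (r s y p : R).

Lemma ler_powRN s y p : 0 < s -> s <= y -> 0 <= p -> y `^ (- p) <= s `^ (- p).
Proof.
move=> s0 sy p0; have y0 := lt_le_trans s0 sy.
rewrite !powRN lef_pV2 ?posrE ?powR_gt0//.
by apply: ge0_ler_powR; rewrite // nnegrE ltW.
Qed.

Lemma exprn_powR s k p : 0 <= s -> (s ^+ k) `^ p = (s `^ p) ^+ k.
Proof. by move=> s0; rewrite -powR_mulrn// powRAC powR_mulrn// powR_ge0. Qed.

Lemma dyadic_scale s : 1 <= s -> exists k : nat, 2 ^+ k <= s < 2 ^+ k.+1.
Proof.
move=> s1; have s0 : 0 <= s by lra.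
have /andP[h1 h2] := truncn_itv s0; set n := Num.truncn s in h1 h2.
have n0 : (0 < n)%N by rewrite truncn_gt0.
exists (trunc_log 2 n); rewrite -!natrX; apply/andP; split.
  by apply: le_trans h1; rewrite ler_nat trunc_logP.
by apply: lt_le_trans h2 _; rewrite ler_nat trunc_log_ltn.
Qed.

End Powers.

(** * Inverse powers near and far from their singularity *)

Section Kernels.
Context {R : realType}.
Implicit Types (c xi z : space R) (r p : R).

(** On the shell r/2^(k+1) < |c - z| <= r/2^k the kernel is at most (r/2^(k+1))^(-p), and the
    enclosing cube has volume 8 r^3 / 8^k. The contributions have ratio 2^p / 8, which is below 1
    because p < 3. *)
Lemma integral_near_le p : 0 < p -> p < 3 -> exists2 C : R, 0 <= C &
  forall c r, 0 < r ->
  (\int[leb3 R]_z (if `|c - z| <= r then `|c - z| `^ (- p) else 0)%:E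
     <= (C * r `^ (3 - p))%:E)%E.
Proof.
move=> p0 p3; pose x : R := 2 `^ p / 8.
have x1 : x < 1.
  rewrite ltr_pdivrMr// mul1r (_ : 8 = 2 `^ (3%:R)); last first.
    by rewrite powR_mulrn//; ring.
  by rewrite /powR !ifF ?pnatr_eq0// ltr_expR ltr_pM2r// ln_gt0// ltr1n.
have x0 : 0 <= x by rewrite divr_ge0// powR_ge0.
exists (8 * 2 `^ p / (1 - x)).
  by rewrite divr_ge0// ?subr_ge0 ?mulr_ge0 ?powR_ge0// ltW.
move=> c r r0.
rewrite [X in (_ <= X%:E)%E](_ : _ = (8 * 2 `^ p * r `^ (3 - p)) / (1 - x)); last by ring.
apply: (@integral_dyadic_le _ c _ (fun k => r / 2 ^+ k)
  (fun k => (r / 2 ^+ k.+1) `^ (- p))) => //.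
- by move=> z; case: ifP => // _; exact: powR_ge0.
- by move=> k; exact: powR_ge0.
- by move=> k; rewrite divr_ge0 ?exprn_ge0// ltW.
- move=> k; have k0 (m : nat) : (0 : R) < 2 ^+ m by rewrite exprn_gt0.
  rewrite powRM ?invr_ge0 ?(ltW r0) ?(ltW (k0 _))// -powR_inv1 ?(ltW (k0 _))//.
  rewrite -powRrM mulrNN mul1r exprn_powR// powRB ?(gt_eqF r0) ?implybT//.
  rewrite (_ : r `^ 3 = r ^+ 3); last by rewrite -powR_mulrn// ltW.
  have -> : x ^+ k = (2 `^ p) ^+ k / (2 ^+ k) ^+ 3.
    by rewrite /x expr_div_n -exprM mulnC exprM; congr (_ / _ ^+ k); ring.
  rewrite powRN exprS le_eqVlt; apply/orP; left; apply/eqP.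
  by field; rewrite !gt_eqF ?powR_gt0.
- move=> z; case: ifPn; last by rewrite ltxx.
  (* At z = c the power of 0 is 0 by convention, so the centre belongs to no shell and needs
     none. *)
  move=> cz; have := normr_ge0 (c - z); rewrite le_eqVlt => /predU1P[<-|cz0 _].
    by rewrite powR0 ?ltxx// oppr_eq0 gt_eqF.
  have [|k /andP[k1 k2]] := @dyadic_scale R (r / `|c - z|).
    by rewrite ler_pdivlMr// mul1r.
  have k0 (m : nat) : (0 : R) < 2 ^+ m by rewrite exprn_gt0.
  exists k; split.
    apply: ler_powRN; last exact: ltW.
      by rewrite divr_gt0.
    by rewrite ler_pdivrMr// mulrC -ler_pdivrMr// ltW.
  by rewrite ler_pdivlMr// mulrC -ler_pdivlMr.
Qed.

(** The shells r 2^k <= |c - z| < r 2^(k+1) now grow outwards, and the ratio 8 / 2^p is below 1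
    because p > 3. *)
Lemma integral_far_le p : 3 < p -> exists2 C : R, 0 <= C &
  forall c r, 0 < r ->
  (\int[leb3 R]_z (if r < `|c - z| then `|c - z| `^ (- p) else 0)%:E
     <= (C * r `^ (3 - p))%:E)%E.
Proof.
move=> p3; pose x : R := 8 * 2 `^ (- p).
have x1 : x < 1.
  rewrite /x (_ : 8 = 2 `^ (3%:R)); last first.
    by rewrite powR_mulrn//; ring.
  rewrite -powRD ?pnatr_eq0 ?implybT//.
  rewrite /powR !ifF ?pnatr_eq0// -[ltRHS]expR0 ltr_expR.
  have l2 : (0 : R) < ln 2 by rewrite ln_gt0// ltr1n.
  by rewrite pmulr_llt0//; lra.
have x0 : 0 <= x by rewrite mulr_ge0// powR_ge0.
exists (64 / (1 - x)).
  by rewrite divr_ge0// subr_ge0 ltW.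
move=> c r r0.
rewrite [X in (_ <= X%:E)%E](_ : _ = (64 * r `^ (3 - p)) / (1 - x)); last by ring.
apply: (@integral_dyadic_le _ c _ (fun k => r * 2 ^+ k.+1)
  (fun k => (r * 2 ^+ k) `^ (- p))) => //.
- by move=> z; case: ifP => // _; exact: powR_ge0.
- by move=> k; exact: powR_ge0.
- by move=> k; rewrite mulr_ge0 ?exprn_ge0// ltW.
- move=> k; have k0 (m : nat) : (0 : R) < 2 ^+ m by rewrite exprn_gt0.
  rewrite powRM ?(ltW r0) ?(ltW (k0 _))//.
  rewrite exprn_powR// powRD ?(gt_eqF r0) ?implybT//.
  rewrite (_ : r `^ 3 = r ^+ 3); last by rewrite -powR_mulrn// ltW.
  have -> : x ^+ k = (2 ^+ k) ^+ 3 * (2 `^ (- p)) ^+ k.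
    by rewrite /x exprMn -exprM mulnC exprM; congr (_ ^+ k * _); ring.
  rewrite [2 ^+ k.+1]exprS le_eqVlt; apply/orP; left; apply/eqP.
  by ring.
- move=> z; case: ifPn; last by rewrite ltxx.
  move=> cz _.
  have [|k /andP[k1 k2]] := @dyadic_scale R (`|c - z| / r).
    by rewrite ler_pdivlMr// mul1r ltW.
  have k0 (m : nat) : (0 : R) < 2 ^+ m by rewrite exprn_gt0.
  exists k; split.
    apply: ler_powRN; last lra.
      by rewrite mulr_gt0.
    by rewrite mulrC -ler_pdivlMr.
  by rewrite mulrC -ler_pdivrMr// ltW.
Qed.

End Kernels.

(** * The convolution estimate *)

Section Conv.
Context {R : realType}.
Implicit Types (c xi z : space R) (r p : R).

Lemma dotE z xi : dot z xi = z.1.1 * xi.1.1 + z.1.2 * xi.1.2 + z.2 * xi.2.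
Proof. by rewrite /dot !big_ord_recr big_ord0/= add0r. Qed.

Lemma dot_ge0 z : 0 <= dot z z.
Proof. by rewrite dotE -!expr2 !addr_ge0 ?sqr_ge0. Qed.

Lemma enorm_ge0 z : 0 <= enorm z.
Proof. exact: sqrtr_ge0. Qed.

Lemma sqr_enorm z : enorm z ^+ 2 = dot z z.
Proof. by rewrite sqr_sqrtr// dot_ge0. Qed.

Lemma norm_le_enorm z : `|z| <= enorm z.
Proof.
have H (x y t : R) : x ^+ 2 <= x ^+ 2 + y ^+ 2 + t ^+ 2.
  by rewrite -addrA lerDl addr_ge0// sqr_ge0.
rewrite space_norm_le /enorm dotE -!expr2 -!sqrtr_sqr !ler_wsqrtr//.
- by rewrite addrC addrA; exact: H.
- by rewrite (addrC (z.1.1 ^+ 2)); exact: H.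
Qed.

Lemma enorm_le_norm z : enorm z <= 2 * `|z|.
Proof.
rewrite -[leRHS]ger0_norm ?mulr_ge0// -sqrtr_sqr ler_wsqrtr// dotE -!expr2.
have : `|z| <= `|z| by [].
rewrite {1}space_norm_le => /and3P[].
have H (x : R) : `|x| <= `|z| -> x ^+ 2 <= `|z| ^+ 2.
  by move=> h; rewrite -real_normK ?num_real// lerXn2r// nnegrE.
move=> /H h1 /H h2 /H h3; rewrite exprMn.
by have := sqr_ge0 `|z|; nra.
Qed.

Lemma enorm_gt0 z : (0 < enorm z) = (z != 0).
Proof.
rewrite -normr_gt0; apply/idP/idP => h.
  by have := enorm_le_norm z; lra.
exact: lt_le_trans h (norm_le_enorm z).
Qed.

Lemma measurable_norm_kernel c (P : pred R) (mP : measurable_fun setT P) p :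
  measurable_fun setT (fun z : mspace R =>
    if P `|(c : space R) - z| then `|(c : space R) - z| `^ (- p) else 0 : R).
Proof.
apply: (measurableT_comp (f := fun y : R => if P y then y `^ (- p) else 0)).
  apply: measurable_fun_if => //; apply: measurable_funTS.
  exact: measurable_powR.
exact: measurable_space_norm.
Qed.

(** Three regions, with r half of |xi|. If |z| <= r then |xi - z| >= r; if |xi - z| <= r then |z| >=
    r; otherwise |z| <= |xi - z| + 2 r <= 3 |xi - z|, so the product is at most 3^p |z|^(-p-2). *)
Lemma norm_kernel_split p r xi z : 0 < r -> `|xi| = 2 * r -> 0 <= p ->
  `|xi - z| `^ (- p) * `|z| `^ (- 2) <=
  r `^ (- p) * (if `|0 - z| <= r then `|0 - z| `^ (- 2) else 0)
  + r `^ (- 2) * (if `|xi - z| <= r then `|xi - z| `^ (- p) else 0)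
  + 3 `^ p * (if r < `|0 - z| then `|0 - z| `^ (- (p + 2)) else 0).
Proof.
move=> r0 xir p0; rewrite sub0r normrN.
have tri : `|xi| <= `|xi - z| + `|z|.
  by rewrite -{1}(subrK z xi) ler_normD.
have tri' : `|z| <= `|xi - z| + `|xi|.
  by rewrite -{1}(subKr xi z) (le_trans (ler_normB _ _))// addrC.
have H1 : 0 <= r `^ (- p) * (if `|z| <= r then `|z| `^ (- 2) else 0).
  by rewrite mulr_ge0 ?powR_ge0//; case: ifP => // _; exact: powR_ge0.
have H2 : 0 <= r `^ (- 2) * (if `|xi - z| <= r then `|xi - z| `^ (- p) else 0).
  by rewrite mulr_ge0 ?powR_ge0//; case: ifP => // _; exact: powR_ge0.
have H3 : 0 <= 3 `^ p * (if r < `|z| then `|z| `^ (- (p + 2)) else 0).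
  by rewrite mulr_ge0 ?powR_ge0//; case: ifP => // _; exact: powR_ge0.
have [zr|zr] := leP `|z| r.
  move: H1 H2 H3; rewrite zr => H1 H2 H3.
  have : `|xi - z| `^ (- p) <= r `^ (- p) by apply: ler_powRN => //; lra.
  move/(ler_wpM2r (powR_ge0 `|z| (- 2))).
  by move: H2 H3; rewrite ltNge zr/=; lra.
have [xz|xz] := leP `|xi - z| r.
  move: H1 H2 H3; rewrite xz zr => H1 H2 H3.
  have : `|z| `^ (- 2) <= r `^ (- 2) by apply: ler_powRN => //; lra.
  move/(ler_wpM2l (powR_ge0 `|xi - z| (- p))).
  by move: H1 H3; rewrite (leNgt `|z|) zr/=; lra.
have z0 : 0 < `|z| by lra.
have : `|xi - z| `^ (- p) <= 3 `^ p * `|z| `^ (- p).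
  rewrite -(invrK 3) -[X in X `^ p]powR_inv1 ?invr_ge0//.
  rewrite -powRrM mulN1r -powRM ?invr_ge0//.
  by apply: ler_powRN => //; lra.
move/(ler_wpM2r (powR_ge0 `|z| (- 2))).
rewrite -mulrA -powRD; last by rewrite (gt_eqF z0) implybT.
by rewrite -opprD; lra.
Qed.

(** All three regions scale like r^(1 - p). The singularity at xi is integrable because p < 3, and
    the tail |z|^(-p-2) because p > 1. *)
Lemma integral_norm_kernel_le p : 1 < p -> p < 3 -> exists2 C : R, 0 <= C &
  forall xi, xi != 0 ->
  (\int[leb3 R]_z (`|xi - z| `^ (- p) * `|z| `^ (- 2))%:E
     <= (C * `|xi| `^ (1 - p))%:E)%E.
Proof.
move=> p1 p3.
have [C1 C10 H1] := @integral_near_le R 2 ltac:(lra) ltac:(lra).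
have [C2 C20 H2] := @integral_near_le R p ltac:(lra) ltac:(lra).
have [C3 C30 H3] := @integral_far_le R (p + 2) ltac:(lra).
(* The factor 2^(p - 1) converts r^(1 - p) back into |xi|^(1 - p). *)
exists ((C1 + C2 + 3 `^ p * C3) * 2 `^ (p - 1)).
  by rewrite mulr_ge0 ?powR_ge0 ?addr_ge0 ?mulr_ge0 ?powR_ge0.
move=> xi xi0; pose r := `|xi| / 2.
have r0 : 0 < r by rewrite divr_gt0// normr_gt0.
have xir : `|xi| = 2 * r by rewrite /r; field.
pose S1 z := if `|0 - z| <= r then `|0 - z| `^ (- 2) else 0.
pose S2 z := if `|xi - z| <= r then `|xi - z| `^ (- p) else 0.
pose L z := if r < `|0 - z| then `|0 - z| `^ (- (p + 2)) else 0.
have S10 z : 0 <= S1 z by rewrite /S1; case: ifP => // _; exact: powR_ge0.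
have S20 z : 0 <= S2 z by rewrite /S2; case: ifP => // _; exact: powR_ge0.
have L0 z : 0 <= L z by rewrite /L; case: ifP => // _; exact: powR_ge0.
have mS1 : measurable_fun setT (S1 : mspace R -> R).
  apply: (@measurable_norm_kernel _ (fun y => y <= r)).
  exact: measurable_fun_ler.
have mS2 : measurable_fun setT (S2 : mspace R -> R).
  apply: (@measurable_norm_kernel _ (fun y => y <= r)).
  exact: measurable_fun_ler.
have mL : measurable_fun setT (L : mspace R -> R).
  apply: (@measurable_norm_kernel _ (fun y => r < y)).
  exact: measurable_fun_ltr.
apply: (@le_trans _ _ (\int[leb3 R]_z ((r `^ (- p))%:E * (S1 z)%:E +
   (r `^ (- 2))%:E * (S2 z)%:E + (3 `^ p)%:E * (L z)%:E))%E).
  apply: ge0_le_integral_nomeas => z _; first by rewrite lee_fin mulr_ge0 ?powR_ge0.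
  by rewrite -!EFinM -!EFinD lee_fin norm_kernel_split//; lra.
have mZ k (f : mspace R -> R) : measurable_fun setT f ->
  measurable_fun setT (fun z => (k%:E * (f z)%:E)%E).
  by move=> mf; apply/measurable_EFinP; exact: measurable_funM.
have g0 k (f : R) : 0 <= k -> 0 <= f -> (0 <= k%:E * f%:E)%E.
  by move=> *; rewrite mule_ge0// lee_fin.
rewrite ge0_integralD//; last 4 first.
- by move=> z _; rewrite adde_ge0// g0// powR_ge0.
- by apply: emeasurable_funD; exact: mZ.
- by move=> z _; rewrite g0// powR_ge0.
- exact: mZ.
rewrite ge0_integralD//; last 4 first.
- by move=> z _; rewrite g0// powR_ge0.
- exact: mZ.
- by move=> z _; rewrite g0// powR_ge0.
- exact: mZ.
have gZ k (f : space R -> R) : 0 <= k -> measurable_fun setT (f : mspace R -> R) ->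
    (forall z, 0 <= f z) ->
    (\int[leb3 R]_z (k%:E * (f z)%:E) = k%:E * \int[leb3 R]_z (f z)%:E)%E.
  move=> k0 mf f0; apply: ge0_integralZl; rewrite ?lee_fin//.
  - exact/measurable_EFinP.
  - by move=> z _; rewrite lee_fin f0.
rewrite !gZ ?powR_ge0//.
apply: (@le_trans _ _ ((r `^ (- p))%:E * (C1 * r `^ (3 - 2))%:E +
   (r `^ (- 2))%:E * (C2 * r `^ (3 - p))%:E +
   (3 `^ p)%:E * (C3 * r `^ (3 - (p + 2)))%:E)%E).
  by rewrite !leeD// lee_wpmul2l ?lee_fin ?powR_ge0//; [exact: H1|exact: H2|exact: H3].
rewrite -!EFinM -!EFinD lee_fin.
have rN0 : r != 0 by rewrite gt_eqF.
have e1 : r `^ (- p) * r `^ (3 - 2) = r `^ (1 - p).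
  by rewrite -powRD ?rN0 ?implybT//; congr (_ `^ _); ring.
have e2 : r `^ (- 2) * r `^ (3 - p) = r `^ (1 - p).
  by rewrite -powRD ?rN0 ?implybT//; congr (_ `^ _); ring.
have -> : 3 - (p + 2) = 1 - p by ring.
have -> : `|xi| `^ (1 - p) = 2 `^ (1 - p) * r `^ (1 - p).
  by rewrite xir powRM// ltW.
have e3 : 2 `^ (p - 1) * 2 `^ (1 - p) = 1 :> R.
  by rewrite -powRD ?pnatr_eq0 ?implybT//; rewrite addrA subrK subrr powRr0.
rewrite mulrCA e1 mulrCA e2 mulrA -!mulrDl.
rewrite [leRHS](_ : _ = (C1 + C2 + 3 `^ p * C3) *
  (2 `^ (p - 1) * 2 `^ (1 - p)) * r `^ (1 - p)); last by ring.
by rewrite (mulrA (3 `^ p)) -mulrDl e3 mulr1.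
Qed.

(** Since the maximum norm is at most [enorm], the Euclidean kernels are the smaller ones. Only the
    right-hand side pays for the change of norm, through [enorm] <= 2 |.|. *)
Lemma integral_enorm_kernel_le p : 1 < p -> p < 3 -> exists2 C : R, 0 <= C &
  forall xi, xi != 0 ->
  (\int[leb3 R]_z (enorm (xi - z) `^ (- p) * enorm z `^ (- 2))%:E
     <= (C * enorm xi `^ (1 - p))%:E)%E.
Proof.
move=> p1 p3; have [C C0 HC] := integral_norm_kernel_le p1 p3.
exists (C * 2 `^ (p - 1)); first by rewrite mulr_ge0 ?powR_ge0.
have le q z : 0 < q -> enorm z `^ (- q) <= `|z| `^ (- q).
  move=> q0; have [->|z0] := eqVneq z 0.
    by rewrite /enorm dotE/= !mul0r !addr0 sqrtr0 normr0.
  by apply: ler_powRN; [rewrite normr_gt0|exact: norm_le_enorm|exact: ltW].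
move=> xi xi0; apply: (@le_trans _ _
    (\int[leb3 R]_z (`|xi - z| `^ (- p) * `|z| `^ (- 2))%:E)%E).
  apply: ge0_le_integral_nomeas => z _; rewrite lee_fin.
    by rewrite mulr_ge0 ?powR_ge0.
  by rewrite ler_pM ?powR_ge0 ?le//; lra.
apply: le_trans (HC _ xi0) _; rewrite lee_fin -mulrA ler_wpM2l//.
have -> : 1 - p = - (p - 1) by ring.
have x0 : 0 < `|xi| by rewrite normr_gt0.
apply: (@le_trans _ _ ((enorm xi / 2) `^ (- (p - 1)))).
  apply: ler_powRN; last lra.
    by rewrite divr_gt0// enorm_gt0.
  by have := enorm_le_norm xi; lra.
rewrite powRM ?invr_ge0 ?enorm_ge0// mulrC -powR_inv1// -powRrM mulrNN mul1r.
by rewrite mulrC mulrC.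
Qed.

End Conv.

(** * The time integral of the heat kernel *)

Section TimeIntegral.
Context {R : realType}.
Notation mu := (@lebesgue_measure R).
Implicit Types (b l t c d : R).

(** Integration by a majorant with an explicit primitive. Derivability of [F'] supplies the
    continuity required by the fundamental theorem of calculus. *)
Lemma integral_le_primitive (f F F' : R -> R) c d : c < d ->
  (forall x, c <= x <= d -> is_derive x 1 F (F' x)) ->
  (forall x, c <= x <= d -> derivable F' x 1) ->
  (forall x, c <= x <= d -> 0 <= f x <= F' x) ->
  (\int[mu]_(x in `[c, d]) (f x)%:E <= (F d - F c)%:E)%E.
Proof.
move=> cd FF' dF' fF'.
apply: (@le_trans _ _ (\int[mu]_(x in `[c, d]) (F' x)%:E)%E).
  by apply: ge0_le_integral_nomeas => x /=; rewrite in_itv/= => /fF'/andP[f0 fF];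
    rewrite lee_fin.
have cF x : c <= x <= d -> {for x, continuous F}.
  move=> /FF' h; apply: differentiable_continuous.
  by apply/derivable1_diffP; exact: ex_derive.
rewrite (@continuous_FTC2 _ _ F)// -?EFinB//.
- by apply: derivable_within_continuous => x /[!in_itv]/=; exact: dF'.
- split.
  + move=> x; rewrite in_itv/= => /andP[cx xd].
    by have h := FF' x; apply: ex_derive; apply: h; rewrite !ltW.
  + by apply: cvg_at_right_filter; apply: cF; rewrite lexx ltW.
  + by apply: cvg_at_left_filter; apply: cF; rewrite lexx ltW.
- move=> x; rewrite in_itv/= => /andP[cx xd]; rewrite derive1E.
  by apply: derive_val; apply: FF'; rewrite !ltW.
Qed.

Lemma integral_powRN_le b d : 0 <= b -> b < 1 -> 0 < d ->
  (\int[mu]_(x in `]0%R, d]) (x `^ (- b))%:E <= (d `^ (1 - b) / (1 - b))%:E)%E.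
Proof.
move=> b0 b1 d0.
have b1' : 1 - b != 0 by rewrite gt_eqF// subr_gt0.
(* The singularity at 0 is approached by compact intervals; [n.+2] keeps them nondegenerate already
   for n = 0. *)
pose I (n : nat) : set R := `[d / n.+2%:R, d]%classic.
have UI : `]0, d]%classic = \bigcup_n I n.
  apply/seteqP; split => x /=; rewrite in_itv/=.
    move=> /andP[x0 xd]; exists (Num.truncn (d / x)) => //=.
    rewrite /I/= in_itv/= xd andbT ler_pdivrMr// mulrC -ler_pdivrMr//.
    have /andP[_ h] := truncn_itv (ltW (divr_gt0 d0 x0)).
    by rewrite (le_trans (ltW h))// ler_nat.
  move=> [n _]; rewrite /I/= in_itv/= => /andP[h ->]; rewrite andbT.
  by apply: lt_le_trans h; rewrite divr_gt0.
rewrite UI.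
have mf (A : set R) : measurable_fun A (fun x : R => (x `^ (- b))%:E).
  by apply/measurable_EFinP; apply: measurable_funTS; exact: measurable_powR.
have mI n : measurable (I n : set (measurableTypeR R)) by exact: measurable_itv.
have ndI : {homo I : n m / (n <= m)%N >-> (n <= m)%O}.
  move=> m n mn; apply/subsetPset => x; rewrite /I/= !in_itv/= => /andP[h ->].
  rewrite andbT; apply: le_trans h; rewrite ler_pM2l// lef_pV2 ?posrE//.
  by rewrite ler_nat.
have cv := @ge0_nondecreasing_set_cvg_integral _ (measurableTypeR R) R I
  (fun x => (x `^ (- b))%:E) mu ndI mI (fun=> mf _)
  (fun i x _ => powR_ge0 x (- b)).
rewrite -(cvg_lim _ cv)//; apply: lime_le; first by apply/cvg_ex; eexists; exact: cv.
apply: nearW => n.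
have dn0 : 0 < d / n.+2%:R by rewrite divr_gt0.
have dn : d / n.+2%:R < d by rewrite ltr_pdivrMr// ltr_pMr// ltr1n.
apply: (@le_trans _ _ (d `^ (1 - b) / (1 - b) -
   (d / n.+2%:R) `^ (1 - b) / (1 - b))%:E).
  apply: (@integral_le_primitive _ (fun x => x `^ (1 - b) / (1 - b)) (fun x => x `^ (- b))) => //.
  - move=> x /andP[h _]; have x0 := lt_le_trans dn0 h.
    have h1 := is_derive1_powR (1 - b) x0.
    apply: is_derive_eq; rewrite !scaler0 add0r.
    by rewrite /GRing.scale/= mulrA mulVf// mul1r; congr (_ `^ _); ring.
  - move=> x /andP[h _]; apply: derivable_powR; rewrite in_itv/= andbT.
    exact: lt_le_trans h.
  - by move=> x _; rewrite powR_ge0 lexx.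
by rewrite lee_fin gerBl divr_ge0 ?powR_ge0// subr_ge0 ltW.
Qed.

(* For [t * l > 1], the function [x `^ (- b) / l / (1 - b) * expR (- (t - x) * l)]
   has a derivative larger than the integrand as soon as [l * x >= 1], and at
   [x = 1 / l] it balances the contribution of [0, 1 / l]. *)
Lemma heat_time_integral_le b l t : 0 <= b -> b < 1 -> 0 < l -> 0 < t ->
  (\int[mu]_(x in `]0%R, t]) (expR (- (t - x) * l) * x `^ (- b))%:E
    <= (t `^ (- b) / l / (1 - b))%:E)%E.
Proof.
move=> b0 b1 l0 t0.
have b1' : 0 < 1 - b by rewrite subr_gt0.
(* If t l <= 1 the exponential is bounded by 1, and t^(1 - b) <= t^(-b) / l. *)
have [tl|tl] := leP (t * l) 1.
  apply: (@le_trans _ _ (\int[mu]_(x in `]0%R, t]) (x `^ (- b))%:E)%E).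
    apply: ge0_le_integral_nomeas => x /=; rewrite in_itv/= => /andP[x0 xt].
      by rewrite lee_fin mulr_ge0 ?expR_ge0 ?powR_ge0.
    rewrite lee_fin ler_piMl ?powR_ge0// -expR0 ler_expR mulNr oppr_le0.
    by rewrite mulr_ge0 ?(ltW l0)// subr_ge0.
  apply: le_trans (integral_powRN_le b0 b1 t0) _.
  rewrite lee_fin ler_pM2r ?invr_gt0// ler_pdivlMr//.
  rewrite powRD; last by rewrite (gt_eqF t0) implybT.
  by rewrite powRr1 ?(ltW t0)// mulrAC ler_piMl// powR_ge0.
pose d := l^-1.
have d0 : 0 < d by rewrite invr_gt0.
have dt : d < t by rewrite /d -[l^-1]mul1r ltr_pdivrMr.
have ld : l * d = 1 by rewrite /d mulfV// gt_eqF.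
pose f x := expR (- (t - x) * l) * x `^ (- b).
have f0 x : 0 <= f x by rewrite mulr_ge0 ?expR_ge0 ?powR_ge0.
have mf (A : set R) : measurable_fun A (fun x => (f x)%:E).
  apply/measurable_EFinP/measurable_funTS; apply: measurable_funM; last first.
    exact: measurable_powR.
  apply: (measurableT_comp (@measurable_expR R)).
  apply: measurable_funM => //; apply: (measurableT_comp (@oppr_measurable R setT)).
  exact: measurable_funB.
have U : `]0, t]%classic = `]0, d]%classic `|` `]d, t]%classic.
  by rewrite -itv_bndbnd_setU// bnd_simp// ltW.
rewrite U ge0_integral_setU//=; last 3 first.
- exact: mf.
- by move=> x _; rewrite lee_fin; exact: f0.
- apply/disj_setPS => x /= [] /=; rewrite !in_itv/= => /andP[_ h1] /andP[h2 _].
  by rewrite ltNge h1 in h2.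
set E := expR (- (t - d) * l).
have E0 : 0 < E by exact: expR_gt0.
(* On ]0, d] the exponential is at most its value [E] at d. The resulting term cancels the lower
   endpoint of the primitive on [d, t], because d^(1 - b) = d^(-b) / l. *)
apply: (@le_trans _ _ ((E * (d `^ (1 - b) / (1 - b)))%:E +
   (t `^ (- b) / l / (1 - b) - d `^ (- b) / l / (1 - b) * E)%:E)%E).
  apply: leeD.
  - apply: (@le_trans _ _ (\int[mu]_(x in `]0%R, d]) (E%:E * (x `^ (- b))%:E))%E).
      apply: ge0_le_integral_nomeas => x /=; rewrite in_itv/= => /andP[x0 xt].
        by rewrite lee_fin f0.
      rewrite -EFinM lee_fin ler_wpM2r ?powR_ge0// ler_expR ler_pM2r// lerN2.
      by rewrite lerB.
    rewrite ge0_integralZl//.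
    + by rewrite EFinM lee_wpmul2l ?lee_fin ?(ltW E0)// integral_powRN_le.
    + apply/measurable_EFinP/measurable_funTS; exact: measurable_powR.
    + by move=> x _; rewrite lee_fin powR_ge0.
    + by rewrite lee_fin ltW.
  rewrite integral_itv_obnd_cbnd//.
  pose G x := x `^ (- b) / l / (1 - b) * expR (- (t - x) * l).
  rewrite (_ : t `^ (- b) / l / (1 - b) = G t); last first.
    by rewrite /G subrr oppr0 mul0r expR0 mulr1.
  pose G' x := (- b * x `^ (- b - 1)) / l / (1 - b) * expR (- (t - x) * l)
     + x `^ (- b) / l / (1 - b) * (expR (- (t - x) * l) * l).
  have de (x : R) : is_derive x 1 (fun y => expR (- (t - y) * l)) (expR (- (t - x) * l) * l).
    apply: is_derive_eq. rewrite /GRing.scale/=. by ring.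
  apply: (@integral_le_primitive _ G G') => // x /andP[dx xt].
  - have x0 := lt_le_trans d0 dx.
    have h1 := is_derive1_powR (- b) x0.
    apply: is_derive_eq; rewrite /GRing.scale/= /G'; ring.
  - have x0 := lt_le_trans d0 dx.
    have h1 := is_derive1_powR (- b) x0.
    have h2 := is_derive1_powR (- b - 1) x0.
    by rewrite /G'; apply: ex_derive.
  - have x0 := lt_le_trans d0 dx.
    rewrite -/(f x) f0/=.
    rewrite /G' powRD ?(gt_eqF x0) ?implybT// powR_inv1 ?(ltW x0)//.
    (* The last factor is at least 1 as soon as l x >= 1, which is what d = 1 / l ensures. *)
    rewrite [leRHS](_ : _ = f x * ((l * x - b) / (l * x * (1 - b)))); last first.
      by rewrite /f; field; rewrite !gt_eqF.
    rewrite ler_peMr// ler_pdivlMr ?mulr_gt0// mul1r.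
    have : 1 <= l * x by rewrite -ld ler_pM2l.
    by nra.
rewrite -EFinD lee_fin powRD ?(gt_eqF d0) ?implybT// powRr1 ?(ltW d0)//.
by rewrite le_eqVlt; apply/orP; left; apply/eqP; rewrite /d; ring.
Qed.

End TimeIntegral.

(** * Reflections and null sets *)

Definition measure_preserving d (T : measurableType d) (R : realType)
    (mu : set T -> \bar R) (f : T -> T) :=
  measurable_fun setT f /\ forall A, measurable A -> mu (f @^-1` A) = mu A.

Section AlmostEverywhere.
Context d (T : measurableType d) (R : realType).
Variable mu : {measure set T -> \bar R}.

Lemma ae_imply (P Q : T -> Prop) : {ae mu, forall x, P x} ->
  (forall x, P x -> Q x) -> {ae mu, forall x, Q x}.
Proof. by move=> hP PQ; apply: filterS hP. Qed.

Lemma ae_imply2 (P Q S : T -> Prop) : {ae mu, forall x, P x} ->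
  {ae mu, forall x, Q x} -> (forall x, P x -> Q x -> S x) ->
  {ae mu, forall x, S x}.
Proof. by move=> hP hQ PQ; apply: filterS2 hP hQ. Qed.

End AlmostEverywhere.

Section MeasurePreserving.
Context {R : realType}.

(** The pushforward of the product measure has the right value on rectangles, so uniqueness of the
    product measure applies. *)
Lemma measure_preserving_prod d1 d2 (T1 : measurableType d1)
    (T2 : measurableType d2) (m1 : {sigma_finite_measure set T1 -> \bar R})
    (m2 : {sigma_finite_measure set T2 -> \bar R}) (f1 : T1 -> T1)
    (f2 : T2 -> T2) :
  measure_preserving m1 f1 -> measure_preserving m2 f2 ->
  measure_preserving (m1 \x m2)%E (fun z : T1 * T2 => (f1 z.1, f2 z.2)).
Proof.
move=> [mf1 p1] [mf2 p2].
have mf : measurable_fun setT (fun z : T1 * T2 => (f1 z.1, f2 z.2)).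
  apply/measurable_fun_pairP; split.
    by apply: (measurableT_comp mf1); exact: measurable_fst.
  by apply: (measurableT_comp mf2); exact: measurable_snd.
split => // X mX.
pose F : {mfun (T1 * T2)%type >-> (T1 * T2)%type} := mfun_Sub (mem_set mf).
symmetry.
apply: (@product_measure_unique _ _ T1 T2 R m1 m2 (pushforward (m1 \x m2)%E F)) => //.
move=> A B mA mB; rewrite -p1// -p2// -product_measure1E//.
  by rewrite -[X in measurable X]setTI; exact: mf1.
by rewrite -[X in measurable X]setTI; exact: mf2.
Qed.

Lemma measure_preserving_reflect (c : R) :
  measure_preserving (@lebesgue_measure R)
    (fun x : measurableTypeR R => c - x : measurableTypeR R).
Proof.
have mf : measurable_fun setT
    (fun x : measurableTypeR R => c - x : measurableTypeR R).
  exact: measurable_funB.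
split => // A mA.
pose F : {mfun measurableTypeR R >-> measurableTypeR R} :=
  @mfun_Sub _ _ (measurableTypeR R) (measurableTypeR R) _ (mem_set mf).
symmetry.
apply: (@lebesgue_measure_unique R (pushforward (@lebesgue_measure R) F)) => //.
move=> _ [[a b] _ <-] /=; rewrite /pushforward/=.
rewrite (_ : _ @^-1` _ = `[c - b, c - a[%classic); last first.
  by apply/seteqP; split => x /=; rewrite !in_itv/= => /andP[? ?]; apply/andP; split; lra.
rewrite !lebesgue_measure_itv/= !lte_fin -!EFinD.
have -> : (c - b < c - a) = (a < b) by apply/idP/idP => ?; lra.
by case: ifP => // _; congr EFin; ring.
Qed.

Lemma sigma_finite_prod d1 d2 (T1 : measurableType d1)
    (T2 : measurableType d2) (m1 : {sigma_finite_measure set T1 -> \bar R})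
    (m2 : {sigma_finite_measure set T2 -> \bar R}) :
  sigma_finite setT (m1 \x m2)%E.
Proof.
have /sigma_finiteP[F [TF ndF Foo]] := sigma_finiteT m1.
have /sigma_finiteP[G [TG ndG Goo]] := sigma_finiteT m2.
exists (fun n => F n `*` G n) => [|k]; last first.
  have [? ?] := Foo k; have [? ?] := Goo k; split; first exact: measurableX.
  by rewrite product_measure1E// lte_mul_pinfty// ge0_fin_numE.
apply/seteqP; split => // -[x y] _.
have [m _ Fx] : (\bigcup_n F n) x by rewrite -TF.
have [n _ Gy] : (\bigcup_n G n) y by rewrite -TG.
exists (maxn m n) => //; split => /=.
  exact: (subsetPset _ _ (ndF _ _ (leq_maxl m n))).
exact: (subsetPset _ _ (ndG _ _ (leq_maxr m n))).
Qed.

(* [leb3] is only declared as a measure; Tonelli's theorem needs copies of it, and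
   of its planar factor, that are known to be sigma-finite. *)
Definition leb2 : set (measurableTypeR R * measurableTypeR R) -> \bar R :=
  (@lebesgue_measure R \x @lebesgue_measure R)%E.

HB.instance Definition _ := Measure.on leb2.
HB.instance Definition _ := Measure_isSigmaFinite.Build _ _ _ leb2
  (sigma_finite_prod (@lebesgue_measure R) (@lebesgue_measure R)).

Definition leb3_fun : set (mspace R) -> \bar R := (leb2 \x @lebesgue_measure R)%E.

HB.instance Definition _ := Measure.on leb3_fun.
HB.instance Definition _ := Measure_isSigmaFinite.Build _ _ _ leb3_fun
  (sigma_finite_prod leb2 (@lebesgue_measure R)).

(** A convolution evaluates its first factor at xi - z; an almost everywhere bound has to survive
    this substitution for each fixed xi. *)
Lemma leb3_reflect (c : space R) :
  measure_preserving (leb3 R) (fun z : mspace R => (c : space R) - z : mspace R).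
Proof.
have h1 := measure_preserving_reflect c.1.1.
have h2 := measure_preserving_reflect c.1.2.
have h3 := measure_preserving_reflect c.2.
have h12 : measure_preserving leb2 _ := measure_preserving_prod h1 h2.
exact: (measure_preserving_prod h12 h3).
Qed.

Lemma ae_preserving d (T : measurableType d) (mu : {measure set T -> \bar R})
    (f : T -> T) (P : T -> Prop) : measure_preserving mu f ->
  {ae mu, forall x, P x} -> {ae mu, forall x, P (f x)}.
Proof.
move=> [mf pf] [N [mN N0 PN]]; exists (f @^-1` N); split.
- by rewrite -[X in measurable X]setTI; exact: mf.
- by rewrite pf.
- by move=> x /= /PN.
Qed.

(** Tonelli's theorem for the indicator of [A]: its integral vanishes in one order, hence in the
    other, and a nonnegative function with zero integral is zero almost everywhere. *)
Lemma ae_null_sections d1 d2 (T1 : measurableType d1)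
    (T2 : measurableType d2) (m1 : {sigma_finite_measure set T1 -> \bar R})
    (m2 : {sigma_finite_measure set T2 -> \bar R}) (A : set (T1 * T2)) :
  measurable A -> (forall x, m2 (xsection A x) = 0%E) ->
  {ae m2, forall y, m1 (ysection A y) = 0%E}.
Proof.
move=> mA A0; have := indic_fubini_tonelli m1 m2 mA.
rewrite indic_fubini_tonelli_FE// indic_fubini_tonelli_GE//.
rewrite (eq_integral (cst 0%E)) => [|x _]; last exact: A0.
rewrite integral0 => /esym E.
have mG := @measurable_fun_ysection _ _ _ _ R m1 A mA.
have /(ae_eq_integral_abs m2 measurableT mG) : (\int[m2]_y `|(m1 \o ysection A) y| = 0)%E.
  by rewrite -E; apply: eq_integral => y _; rewrite gee0_abs//=.
by apply: filterS => y /(_ I).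
Qed.

End MeasurePreserving.

(** * Complex vectors and vector-valued integrals *)

Section ComplexVectors.
Context {R : realType}.
Implicit Types (c : R[i]) (u v : 'cV[R[i]]_3) (xi : space R).


Lemma ReD c1 c2 : complex.Re (c1 + c2) = complex.Re c1 + complex.Re c2.
Proof. by case: c1; case: c2. Qed.

Lemma ImD c1 c2 : complex.Im (c1 + c2) = complex.Im c1 + complex.Im c2.
Proof. by case: c1; case: c2. Qed.

Lemma ReM_real (r : R) c : complex.Re ((r%:C)%C * c) = r * complex.Re c.
Proof. by case: c => a b /=; rewrite mul0r subr0. Qed.

Lemma ImM_real (r : R) c : complex.Im ((r%:C)%C * c) = r * complex.Im c.
Proof. by case: c => a b /=; rewrite mul0r addr0. Qed.

Lemma cmod_ge0 c : 0 <= cmod c.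
Proof. exact: sqrtr_ge0. Qed.

Lemma sqr_cmod c : cmod c ^+ 2 = complex.Re c ^+ 2 + complex.Im c ^+ 2.
Proof. by rewrite sqr_sqrtr// addr_ge0// sqr_ge0. Qed.

Lemma cmodM c1 c2 : cmod (c1 * c2) = cmod c1 * cmod c2.
Proof.
rewrite /cmod -sqrtrM ?addr_ge0 ?sqr_ge0//; congr Num.sqrt.
by case: c1 => a b; case: c2 => a' b' /=; ring.
Qed.

Lemma cmod_real (r : R) : cmod (r%:C)%C = `|r|.
Proof. by rewrite /cmod/= expr0n addr0 sqrtr_sqr. Qed.

Lemma cmod_i : cmod 'i%C = 1 :> R.
Proof. by rewrite /cmod/= expr0n expr1n add0r sqrtr1. Qed.

Lemma normr_Re_le c : `|complex.Re c| <= cmod c.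
Proof. by rewrite -sqrtr_sqr ler_wsqrtr// lerDl sqr_ge0. Qed.

Lemma normr_Im_le c : `|complex.Im c| <= cmod c.
Proof. by rewrite -sqrtr_sqr ler_wsqrtr// lerDr sqr_ge0. Qed.

Lemma cmod_le c : cmod c <= `|complex.Re c| + `|complex.Im c|.
Proof.
have h : 0 <= `|complex.Re c| + `|complex.Im c| by rewrite addr_ge0.
rewrite -(@ler_pXn2r _ 2) ?nnegrE ?cmod_ge0// sqr_cmod sqrrD !real_normK ?num_real//.
by rewrite -addrA [_ *+ 2 + _]addrC addrA lerDl mulrn_wge0// mulr_ge0.
Qed.

(** The inner product of C^3 seen as R^6, that is, the real part of the Hermitian product. *)
Definition cvdot u v : R := \sum_(j < 3)
  (complex.Re (u j 0) * complex.Re (v j 0) +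
   complex.Im (u j 0) * complex.Im (v j 0)).

Lemma cvnorm_ge0 v : 0 <= cvnorm v.
Proof. exact: sqrtr_ge0. Qed.

Lemma sqr_cvnorm v : cvnorm v ^+ 2 = cvdot v v.
Proof.
rewrite sqr_sqrtr; last by apply: sumr_ge0 => j _; exact: sqr_ge0.
by apply: eq_bigr => j _; rewrite sqr_cmod !expr2.
Qed.

(** Cauchy-Schwarz through Lagrange's identity in R^6: the defect is the sum of the squares of the
    fifteen 2 by 2 minors. *)
Lemma normr_cvdot_le u v : `|cvdot u v| <= cvnorm u * cvnorm v.
Proof.
rewrite -(@ler_pXn2r _ 2) ?nnegrE ?mulr_ge0 ?cvnorm_ge0// real_normK ?num_real//.
rewrite exprMn !sqr_cvnorm /cvdot !big_ord_recr !big_ord0/= !add0r.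
set x1 := complex.Re (u _ 0); set x2 := complex.Im (u _ 0).
set x3 := complex.Re (u _ 0); set x4 := complex.Im (u _ 0).
set x5 := complex.Re (u _ 0); set x6 := complex.Im (u _ 0).
set y1 := complex.Re (v _ 0); set y2 := complex.Im (v _ 0).
set y3 := complex.Re (v _ 0); set y4 := complex.Im (v _ 0).
set y5 := complex.Re (v _ 0); set y6 := complex.Im (v _ 0).
rewrite -subr_ge0 (_ : _ - _ = (x1 * y2 - x2 * y1) ^+ 2 +
 (x1 * y3 - x3 * y1) ^+ 2 + (x1 * y4 - x4 * y1) ^+ 2 + (x1 * y5 - x5 * y1) ^+ 2 +
 (x1 * y6 - x6 * y1) ^+ 2 + (x2 * y3 - x3 * y2) ^+ 2 + (x2 * y4 - x4 * y2) ^+ 2 +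
 (x2 * y5 - x5 * y2) ^+ 2 + (x2 * y6 - x6 * y2) ^+ 2 + (x3 * y4 - x4 * y3) ^+ 2 +
 (x3 * y5 - x5 * y3) ^+ 2 + (x3 * y6 - x6 * y3) ^+ 2 + (x4 * y5 - x5 * y4) ^+ 2 +
 (x4 * y6 - x6 * y4) ^+ 2 + (x5 * y6 - x6 * y5) ^+ 2); last by ring.
by rewrite !addr_ge0 ?sqr_ge0.
Qed.

Lemma cvdotDr u v w : cvdot u (v + w) = cvdot u v + cvdot u w.
Proof.
rewrite /cvdot -big_split/=; apply: eq_bigr => j _.
by rewrite !mxE ReD ImD; ring.
Qed.

Lemma cvdotC u v : cvdot u v = cvdot v u.
Proof. by apply: eq_bigr => j _; rewrite mulrC [X in _ + X]mulrC. Qed.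

Lemma cvnormD u v : cvnorm (u + v) <= cvnorm u + cvnorm v.
Proof.
rewrite -(@ler_pXn2r _ 2) ?nnegrE ?addr_ge0 ?cvnorm_ge0// sqr_cvnorm.
rewrite cvdotDr cvdotC cvdotDr [X in _ + X]cvdotC cvdotDr (cvdotC v u).
rewrite -!sqr_cvnorm sqrrD mulr2n.
by have := le_trans (ler_norm _) (normr_cvdot_le u v); lra.
Qed.

Lemma cvnormZ c v : cvnorm (c *: v) = cmod c * cvnorm v.
Proof.
rewrite /cvnorm -[X in X * _]ger0_norm ?cmod_ge0// -sqrtr_sqr -sqrtrM ?sqr_ge0//.
congr Num.sqrt; rewrite mulr_sumr; apply: eq_bigr => j _.
by rewrite mxE cmodM exprMn.
Qed.

Lemma cmodD c1 c2 : cmod (c1 + c2) <= cmod c1 + cmod c2.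
Proof.
pose v : 'cV[R[i]]_3 := const_mx 1.
have v0 : 0 < cvnorm v.
  rewrite sqrtr_gt0 (eq_bigr (fun=> 1)).
    by rewrite sumr_const card_ord ltr0n.
  by move=> j _; rewrite mxE (cmod_real 1) normr1 expr1n.
rewrite -(ler_pM2r v0) mulrDl -!cvnormZ scalerDl; exact: cvnormD.
Qed.

Lemma cvnormN v : cvnorm (- v) = cvnorm v.
Proof.
have <- : ((- 1)%:C)%C *: v = - v.
  by rewrite rmorphN rmorph1 scaleN1r.
by rewrite cvnormZ cmod_real normrN normr1 mul1r.
Qed.

Lemma cmod_le_cvnorm v j : cmod (v j 0) <= cvnorm v.
Proof.
rewrite -[leLHS]ger0_norm ?cmod_ge0// -sqrtr_sqr ler_wsqrtr//.
rewrite (bigD1 j)//= lerDl; apply: sumr_ge0 => i _; exact: sqr_ge0.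
Qed.

Lemma cvnorm_le v : cvnorm v <= \sum_(j < 3) cmod (v j 0).
Proof.
have h : 0 <= \sum_(j < 3) cmod (v j 0) by apply: sumr_ge0 => j _; exact: cmod_ge0.
rewrite -(@ler_pXn2r _ 2) ?nnegrE ?cvnorm_ge0// sqr_sqrtr; last first.
  by apply: sumr_ge0 => j _; exact: sqr_ge0.
rewrite !big_ord_recr !big_ord0/= !add0r.
have := cmod_ge0 (v (widen_ord (leqnSn 2) (widen_ord (leqnSn 1) ord_max)) 0).
have := cmod_ge0 (v (widen_ord (leqnSn 2) ord_max) 0).
have := cmod_ge0 (v ord_max 0).
by nra.
Qed.

(** The symbol is real, so it acts separately on real and imaginary parts. On each, with s = xi . x,
    projecting removes exactly s^2 / |xi|^2 from the squared length; at xi = 0 the convention on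
    inverses turns the symbol into the identity. *)
Lemma cvnorm_leray xi v : cvnorm (leray xi *m v) <= cvnorm v.
Proof.
rewrite -(@ler_pXn2r _ 2) ?nnegrE ?cvnorm_ge0// !sqr_cvnorm.
have HR j : complex.Re ((leray xi *m v) j 0) = complex.Re (v j 0) -
    coord xi j * (\sum_(k < 3) coord xi k * complex.Re (v k 0)) / enorm xi ^+ 2.
  rewrite mxE (eq_bigr (fun k => (((j == k)%:R -
    coord xi j * coord xi k / enorm xi ^+ 2)%:C)%C * v k 0)); last first.
    by move=> k _; rewrite mxE.
  rewrite (big_morph _ ReD (erefl _)).
  under eq_bigr do rewrite ReM_real mulrBl.
  rewrite sumrB; congr (_ - _).
    rewrite (bigD1 j)//= eqxx mul1r big1 ?addr0// => k /negbTE.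
    by rewrite eq_sym => ->; rewrite mul0r.
  by rewrite mulr_sumr mulr_suml; apply: eq_bigr => k _; ring.
have HI j : complex.Im ((leray xi *m v) j 0) = complex.Im (v j 0) -
    coord xi j * (\sum_(k < 3) coord xi k * complex.Im (v k 0)) / enorm xi ^+ 2.
  rewrite mxE (eq_bigr (fun k => (((j == k)%:R -
    coord xi j * coord xi k / enorm xi ^+ 2)%:C)%C * v k 0)); last first.
    by move=> k _; rewrite mxE.
  rewrite (big_morph _ ImD (erefl _)).
  under eq_bigr do rewrite ImM_real mulrBl.
  rewrite sumrB; congr (_ - _).
    rewrite (bigD1 j)//= eqxx mul1r big1 ?addr0// => k /negbTE.
    by rewrite eq_sym => ->; rewrite mul0r.
  by rewrite mulr_sumr mulr_suml; apply: eq_bigr => k _; ring.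
have key (x : 'I_3 -> R) : \sum_(j < 3) (x j - coord xi j *
    (\sum_(k < 3) coord xi k * x k) / enorm xi ^+ 2) ^+ 2 <= \sum_(j < 3) x j ^+ 2.
  set s := \sum_(k < 3) coord xi k * x k.
  have [q0|q0] := eqVneq (enorm xi ^+ 2) 0.
    by apply: ler_sum => j _; rewrite q0 invr0 mulr0 subr0.
  rewrite -subr_ge0 (_ : _ - _ = s ^+ 2 / enorm xi ^+ 2).
    by rewrite divr_ge0// sqr_ge0.
  have qE : enorm xi ^+ 2 = \sum_(j < 3) coord xi j ^+ 2.
    by rewrite sqr_enorm /dot; apply: eq_bigr => j _; rewrite expr2.
  rewrite -sumrB.
  transitivity (2 * s * (\sum_(j < 3) coord xi j * x j) / enorm xi ^+ 2 -
     (\sum_(j < 3) coord xi j ^+ 2) * s ^+ 2 / (enorm xi ^+ 2) ^+ 2).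
    rewrite mulr_sumr !mulr_suml -sumrB; apply: eq_bigr => j _.
    by field; rewrite -sqrf_eq0.
  by rewrite -qE -/s; field; rewrite -sqrf_eq0.
rewrite /cvdot (eq_bigr (fun j => complex.Re ((leray xi *m v) j 0) ^+ 2 +
  complex.Im ((leray xi *m v) j 0) ^+ 2)); last by move=> j _; rewrite !expr2.
rewrite [leRHS](eq_bigr (fun j => complex.Re (v j 0) ^+ 2 +
  complex.Im (v j 0) ^+ 2)); last by move=> j _; rewrite !expr2.
rewrite !big_split/=; apply: lerD.
  by under eq_bigr do rewrite HR; exact: key.
by under eq_bigr do rewrite HI; exact: key.
Qed.

End ComplexVectors.

(** * Integral bounds with and without measurability *)

Section Integrals.
Context d (T : measurableType d) (R : realType).
Variables (mu : {measure set T -> \bar R}) (D : set T).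
Hypothesis mD : measurable D.
Implicit Types (f g : T -> R) (G : R).

(** Only [g] is measurable, so it is [g] that is modified: raised to +oo on the null set, it keeps
    its integral and dominates [f] everywhere. *)
Lemma ae_le_integral_nomeas (f g : T -> \bar R) : measurable_fun D g ->
  (forall x, D x -> (0 <= f x)%E) -> (forall x, D x -> (0 <= g x)%E) ->
  {ae mu, forall x, D x -> (f x <= g x)%E} ->
  (\int[mu]_(x in D) f x <= \int[mu]_(x in D) g x)%E.
Proof.
move=> mg f0 g0 [N [mN N0 fgN]].
pose h x : \bar R := if x \in N then +oo%E else g x.
rewrite (@ge0_ae_eq_integral _ _ _ mu D g h)//.
- apply: ge0_le_integral_nomeas => // x Dx; rewrite /h.
  case: ifPn => [_|/negP xN]; first by rewrite leey.
  by apply: contrapT => fgx; apply: xN; rewrite inE; apply: fgN => /(_ Dx).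
- apply: measurable_fun_if => //.
  + apply: (measurable_fun_bool true); apply: measurableI => //.
    by rewrite (_ : _ @^-1` _ = N)//; apply/seteqP; split=> x; [exact: set_mem|exact: mem_set].
  + by apply: measurable_funS mg => // x [].
- by move=> x Dx; rewrite /h; case: ifP => // _; exact: g0.
- exists N; split => // x /=; apply: contra_notP => xN _.
  by rewrite /h ifN//; apply/negP; rewrite inE.
Qed.

(** The integrals of the positive and negative parts both lie in [0, G], so their difference lies in
    [-G, G]. No additivity is used, hence no measurability of [f]. *)
Lemma le_normr_Rintegral_nomeas f g G : measurable_fun D g ->
  (forall x, D x -> 0 <= g x) -> {ae mu, forall x, D x -> `|f x| <= g x} ->
  (\int[mu]_(x in D) (g x)%:E <= G%:E)%E ->
  `|\int[mu]_(x in D) f x| <= G.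
Proof.
move=> mg g0 fg gG; rewrite /Rintegral integralE.
have gG' (h : T -> \bar R) : (forall x, D x -> (0 <= h x)%E) ->
    {ae mu, forall x, D x -> (h x <= (g x)%:E)%E} ->
    exists2 r, (\int[mu]_(x in D) h x)%E = r%:E & 0 <= r <= G.
  move=> h0 hg; have hG : (\int[mu]_(x in D) h x <= G%:E)%E.
    apply: le_trans gG; apply: ae_le_integral_nomeas => //.
    exact/measurable_EFinP.
  have hp : (0 <= \int[mu]_(x in D) h x)%E by exact: integral_ge0.
  move: hG hp; case: (integral _ _ _) => // r.
  by rewrite !lee_fin => rG r0; exists r => //; rewrite r0.
have [|r1 -> /andP[a1 b1]] := gG' ((fun x => (f x)%:E)^\+)%E (fun x _ => funepos_ge0 _ x).
  apply: filterS fg => x h /h; rewrite -lee_fin -abse_EFin; apply: le_trans.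
  have /(congr1 (fun F => F x)) /= -> := fune_abse (fun x => (f x)%:E).
  by rewrite leeDl.
have [|r2 -> /andP[a2 b2]] := gG' ((fun x => (f x)%:E)^\-)%E (fun x _ => funeneg_ge0 _ x).
  apply: filterS fg => x h /h; rewrite -lee_fin -abse_EFin; apply: le_trans.
  have /(congr1 (fun F => F x)) /= -> := fune_abse (fun x => (f x)%:E).
  by rewrite leeDr.
by rewrite -EFinB/= ler_norml; lra.
Qed.

(** Integrability and value are bundled so that linearity can be applied to finite combinations in
    one pass. *)
Definition has_int f (r : R) :=
  mu.-integrable D (EFin \o f) /\ \int[mu]_(x in D) f x = r.

Lemma has_intD f g r s : has_int f r -> has_int g s ->
  has_int (fun x => f x + g x) (r + s).
Proof.
move=> [fi <-] [gi <-]; split; last by rewrite RintegralD.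
rewrite (_ : EFin \o _ = (EFin \o f) \+ (EFin \o g))%E//.
exact: integrableD.
Qed.

Lemma has_intZ f r k : has_int f r -> has_int (fun x => k * f x) (k * r).
Proof.
move=> [fi <-]; split; last by rewrite RintegralZl.
rewrite (_ : EFin \o _ = (fun x => k%:E * (EFin \o f) x)%E)//.
exact: integrableZl.
Qed.

Lemma has_int_sum (F : 'I_3 -> T -> R) (r : 'I_3 -> R) :
  (forall j, has_int (F j) (r j)) ->
  has_int (fun x => \sum_(j < 3) F j x) (\sum_(j < 3) r j).
Proof.
move=> h; rewrite (_ : (fun _ => _) = (fun x => F 0 x + F 1 x + F (inord 2) x)); last first.
  apply/funext => x; rewrite !big_ord_recr big_ord0/= add0r.
  by congr (F _ x + F _ x + F _ x); apply/val_inj => //=; rewrite inordK.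
rewrite (_ : \sum_(j < 3) r j = r 0 + r 1 + r (inord 2)); last first.
  rewrite !big_ord_recr big_ord0/= add0r.
  by congr (r _ + r _ + r _); apply/val_inj => //=; rewrite inordK.
by do 2 (apply: has_intD => //).
Qed.

Lemma ae_le_integrable f g G : measurable_fun D f -> measurable_fun D g ->
  (forall x, D x -> 0 <= g x) -> {ae mu, forall x, D x -> `|f x| <= g x} ->
  (\int[mu]_(x in D) (g x)%:E <= G%:E)%E -> mu.-integrable D (EFin \o f).
Proof.
move=> mf mg g0 fg gG; apply/integrableP; split; first exact/measurable_EFinP.
apply: le_lt_trans (ltry G); apply: le_trans gG.
by apply: ae_le_integral_nomeas => //; exact/measurable_EFinP.
Qed.

(** Minkowski's inequality by duality: the integral I satisfies I . I = integral of I . h <= |I| G,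
    and |I| cancels. Moving I inside is where measurability of [h] enters. *)
Lemma cvnorm_Cintegral_le (h : T -> 'cV[R[i]]_3) g G :
  (forall j, Cmeasurable D (fun y => h y j 0)) -> measurable_fun D g ->
  (forall x, D x -> 0 <= g x) ->
  {ae mu, forall x, D x -> cvnorm (h x) <= g x} ->
  (\int[mu]_(x in D) (g x)%:E <= G%:E)%E ->
  cvnorm (\col_j Cintegral mu D (fun y => h y j 0)) <= G.
Proof.
move=> mh mg g0 hg gG; set I := \col_j _.
have hR j : has_int (fun y => complex.Re (h y j 0)) (complex.Re (I j 0)).
  split; last by rewrite mxE.
  apply: ae_le_integrable (mh j).1 mg g0 _ gG; apply: filterS hg => x hgx /hgx.
  apply: le_trans; apply: le_trans (normr_Re_le _) (cmod_le_cvnorm _ _).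
have hI j : has_int (fun y => complex.Im (h y j 0)) (complex.Im (I j 0)).
  split; last by rewrite mxE.
  apply: ae_le_integrable (mh j).2 mg g0 _ gG; apply: filterS hg => x hgx /hgx.
  apply: le_trans; apply: le_trans (normr_Im_le _) (cmod_le_cvnorm _ _).
have G0 : 0 <= G.
  by rewrite -lee_fin (le_trans _ gG)// integral_ge0.
have [If IE] : has_int (fun y => cvdot I (h y)) (cvdot I I).
  by apply: has_int_sum => j; apply: has_intD; exact: has_intZ.
have : cvdot I I <= cvnorm I * G.
  rewrite -IE (le_trans (ler_norm _))//.
  apply: (@le_normr_Rintegral_nomeas _ (fun y => cvnorm I * g y)).
  - exact: measurable_funM.
  - by move=> x Dx; rewrite mulr_ge0 ?cvnorm_ge0 ?g0.
  - apply: filterS hg => x hgx /hgx h1; apply: le_trans (normr_cvdot_le _ _) _.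
    by rewrite ler_wpM2l ?cvnorm_ge0.
  - under eq_integral do rewrite EFinM.
    rewrite ge0_integralZl//.
    + by rewrite EFinM lee_wpmul2l// lee_fin cvnorm_ge0.
    + exact/measurable_EFinP.
    + by rewrite lee_fin cvnorm_ge0.
rewrite -sqr_cvnorm expr2.
have := cvnorm_ge0 I; rewrite le_eqVlt => /predU1P[<- _//|I0].
by rewrite ler_pM2l.
Qed.

Lemma cmod_Cintegral_le (h : T -> R[i]) g G : measurable_fun D g ->
  (forall x, D x -> 0 <= g x) ->
  {ae mu, forall x, D x -> cmod (h x) <= g x} ->
  (\int[mu]_(x in D) (g x)%:E <= G%:E)%E ->
  cmod (Cintegral mu D h) <= 2 * G.
Proof.
move=> mg g0 hg gG; apply: le_trans (cmod_le _) _.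
have -> : 2 * G = G + G by ring.
apply: lerD => /=; apply: le_normr_Rintegral_nomeas mg g0 _ gG;
  apply: filterS hg => x hgx /hgx; apply: le_trans.
  exact: normr_Re_le.
exact: normr_Im_le.
Qed.

End Integrals.

(** * The nonlinear term *)

Section Nonlinear.
Context {R : realType}.
Notation mu := (@lebesgue_measure R).
Implicit Types (c xi z : space R) (t l : R).

Lemma measurable_enorm c :
  measurable_fun setT (fun z : mspace R => enorm ((c : space R) - z) : R).
Proof.
rewrite (_ : (fun _ => _) = (fun z : mspace R =>
  ((c.1.1 - z.1.1) * (c.1.1 - z.1.1) + (c.1.2 - z.1.2) * (c.1.2 - z.1.2) +
   (c.2 - z.2) * (c.2 - z.2)) `^ 2^-1)); last first.
  apply/funext => z; rewrite powR12_sqrt; last by rewrite -!expr2 !addr_ge0 ?sqr_ge0.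
  by rewrite /enorm dotE.
have m11 : measurable_fun setT (fun z : mspace R => c.1.1 - z.1.1 : R).
  by apply: measurable_funB => //; apply: measurableT_comp => //; exact: measurable_fst.
have m12 : measurable_fun setT (fun z : mspace R => c.1.2 - z.1.2 : R).
  by apply: measurable_funB => //; apply: measurableT_comp => //; exact: measurable_fst.
have m2 : measurable_fun setT (fun z : mspace R => c.2 - z.2 : R).
  by apply: measurable_funB => //; exact: measurable_snd.
apply: (measurableT_comp (@measurable_powR R _)).
apply: measurable_funD; last exact: measurable_funM.
by apply: measurable_funD; exact: measurable_funM.
Qed.

Lemma measurable_enorm0 : measurable_fun setT (fun z : mspace R => enorm (z : space R) : R).
Proof.
rewrite (_ : (fun _ => _) = (fun z : mspace R => enorm ((0 : space R) - z))).
  exact: measurable_enorm.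
by apply/funext => z; rewrite /enorm !dotE/= !sub0r !mulrNN.
Qed.

Lemma ae_neq0 : {ae leb3 R, forall z, z != 0 :> space R}.
Proof.
exists [set z : space R | `|0 - z| <= 0]; split.
- exact: measurable_cube.
- by rewrite leb3_cube// mulr0 expr0n.
- by move=> z /= /negP; rewrite negbK => /eqP ->; rewrite subrr normr0.
Qed.

Lemma fourier_cst_ge0 : 0 <= fourier_cst R.
Proof. exact: powR_ge0. Qed.

Lemma normr_coord_le_enorm xi j : `|coord xi j| <= enorm xi.
Proof. exact: le_trans (le_coord_norm _ _) (norm_le_enorm _). Qed.

(** One factor of the product is measured by the mixed bound, the other by [M] alone. The kernels
    yield |xi|^(1 - a) and |xi|^(-1), and the derivative multiplies them by |xi|. *)
Lemma cvnorm_div_tensor_hat_le a : 2 <= a -> a < 3 -> exists2 C : R, 0 <= C &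
  forall (V : space R -> 'cV[R[i]]_3) (P Q M : R), 0 <= P -> 0 <= Q -> 0 <= M ->
  {ae leb3 R, forall z, cvnorm (V z) <= P * enorm z `^ (- a) + Q * enorm z `^ (- 2)} ->
  {ae leb3 R, forall z, cvnorm (V z) <= M * enorm z `^ (- 2)} ->
  forall xi, xi != 0 ->
  cvnorm (div_tensor_hat V V xi) <= C * M * (P * enorm xi `^ (2 - a) + Q).
Proof.
move=> a2 a3.
have [C1 C10 H1] := @integral_enorm_kernel_le R a ltac:(lra) ltac:(lra).
have [C2 C20 H2] := @integral_enorm_kernel_le R 2 ltac:(lra) ltac:(lra).
(* 18 = 3 . 3 . 2: three components, three terms in each divergence, and the factor 2 of a complex
   integral. *)
exists (18 * fourier_cst R * (C1 + C2)).
  by rewrite !mulr_ge0 ?addr_ge0 ?fourier_cst_ge0.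
move=> V P Q M P0 Q0 M0 VPQ VM xi xi0.
have e0 : 0 < enorm xi by rewrite enorm_gt0.
set e := enorm xi in e0 *.
pose G := M * (P * (C1 * e `^ (1 - a)) + Q * (C2 * e `^ (1 - 2))).
have cG k j : cmod (conv (fun z => V z k 0) (fun z => V z j 0) xi) <= 2 * G.
  have mk q : measurable_fun setT
      (fun z : mspace R => enorm ((xi : space R) - z) `^ (- q) * enorm (z : space R) `^ (- 2) : R).
    apply: measurable_funM; apply: (measurableT_comp (@measurable_powR R _)).
      exact: measurable_enorm.
    exact: measurable_enorm0.
  have k0 q z : 0 <= enorm (xi - z) `^ (- q) * enorm z `^ (- 2).
    by rewrite mulr_ge0 ?powR_ge0.
  pose g z := (M * P) * (enorm (xi - z) `^ (- a) * enorm z `^ (- 2)) +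
              (M * Q) * (enorm (xi - z) `^ (- 2) * enorm z `^ (- 2)).
  apply: (@cmod_Cintegral_le _ _ _ (leb3 R) setT _ _ g) => //.
  - by apply: measurable_funD; exact: measurable_funM.
  - by move=> z _; rewrite addr_ge0// mulr_ge0// mulr_ge0.
  - have VPQ' := ae_preserving (leb3_reflect xi) VPQ.
    apply: filterS2 VPQ' VM => z h1 h2 _; rewrite cmodM.
    apply: (@le_trans _ _ ((P * enorm (xi - z) `^ (- a) +
        Q * enorm (xi - z) `^ (- 2)) * (M * enorm z `^ (- 2)))).
      apply: ler_pM; rewrite ?cmod_ge0//.
        exact: le_trans (cmod_le_cvnorm _ _) h1.
      exact: le_trans (cmod_le_cvnorm _ _) h2.
    by rewrite le_eqVlt; apply/orP; left; apply/eqP; rewrite /g; ring.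
  - under eq_integral do rewrite EFinD !(EFinM (M * _)).
    have mE q r : measurable_fun setT (fun z : mspace R =>
        (r%:E * (enorm ((xi : space R) - z) `^ (- q) * enorm (z : space R) `^ (- 2))%:E)%E).
      by apply/measurable_EFinP; apply: measurable_funM.
    rewrite ge0_integralD//; try exact: mE;
      try by move=> z _; rewrite mule_ge0// lee_fin// mulr_ge0.
    rewrite !ge0_integralZl//; try (by rewrite lee_fin mulr_ge0); try exact/measurable_EFinP;
      try by move=> z _; rewrite lee_fin.
    rewrite [G%:E](_ : _ = (M * P)%:E * (C1 * e `^ (1 - a))%:E +
        (M * Q)%:E * (C2 * e `^ (1 - 2))%:E)%E; last first.
      by rewrite -!EFinM -EFinD /G; congr EFin; ring.
    by apply: leeD; rewrite lee_wpmul2l ?lee_fin ?mulr_ge0//; [exact: H1|exact: H2].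
have G0 : 0 <= 2 * G by exact: le_trans (cmod_ge0 _) (cG 0 0).
apply: le_trans (cvnorm_le _) _.
have hj j : cmod (div_tensor_hat V V xi j 0) <= 3 * (e * (fourier_cst R * (2 * G))).
  rewrite mxE.
  have -> : 3 * (e * (fourier_cst R * (2 * G))) =
      \sum_(k < 3) (e * (fourier_cst R * (2 * G))).
    by rewrite sumr_const card_ord mulr_natl.
  apply: (@le_trans _ _ (\sum_(k < 3) cmod ('i%C * ((coord xi k)%:C)%C *
    (((fourier_cst R)%:C)%C * conv (fun z => V z k 0) (fun z => V z j 0) xi)))).
    apply: (big_ind2 (fun (x : R[i]) y => cmod x <= y)) => //.
      by rewrite /cmod/= expr0n addr0 sqrtr0.
    move=> x1 y1 x2 y2 h1 h2; exact: le_trans (cmodD _ _) (lerD h1 h2).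
  apply: ler_sum => k _; rewrite !cmodM cmod_i mul1r !cmod_real.
  apply: ler_pM; rewrite ?mulr_ge0 ?cmod_ge0//; first exact: normr_coord_le_enorm.
  by rewrite ger0_norm ?fourier_cst_ge0// ler_wpM2l// fourier_cst_ge0.
apply: (@le_trans _ _ (\sum_(j < 3) (3 * (e * (fourier_cst R * (2 * G)))))).
  by apply: ler_sum => j _; exact: hj.
rewrite sumr_const card_ord -mulr_natl /G.
have -> : e `^ (1 - a) = e `^ (2 - a) / e.
  rewrite -[X in _ / X]powRr1 ?(ltW e0)// -powRB ?(gt_eqF e0) ?implybT//.
  by congr (_ `^ _); ring.
have -> : e `^ (1 - 2) = e^-1.
  by rewrite (_ : 1 - 2 = - 1); [rewrite powR_inv1// ltW|ring].
rewrite [leLHS](_ : _ = 18 * fourier_cst R * M *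
   (C1 * (P * e `^ (2 - a)) + C2 * Q)); last by field; rewrite gt_eqF.
rewrite [leRHS](_ : _ = 18 * fourier_cst R * M *
   ((C1 + C2) * (P * e `^ (2 - a) + Q))); last by ring.
rewrite ler_wpM2l ?mulr_ge0 ?fourier_cst_ge0//.
have : 0 <= P * e `^ (2 - a) by rewrite mulr_ge0 ?powR_ge0.
by nra.
Qed.

End Nonlinear.

(** * Duhamel integrals *)

Section Duhamel.
Context {R : realType}.
Notation mu := (@lebesgue_measure R).
Implicit Types (xi z : space R) (t l b P Q : R).

Lemma cmod_heat t xi : cmod (heat t xi) = expR (- t * enorm xi ^+ 2).
Proof. by rewrite cmod_real ger0_norm ?expR_ge0. Qed.

Lemma measurable_heat_time l t : measurable_fun setT (fun x : R => expR (- (t - x) * l)).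
Proof.
apply: (measurableT_comp (@measurable_expR R)).
apply: measurable_funM => //; apply: (measurableT_comp (@oppr_measurable R setT)).
exact: measurable_funB.
Qed.

Lemma heat_time_integral_cc_le b l t P Q : 0 <= b -> b < 1 -> 0 < l -> 0 < t ->
  0 <= P -> 0 <= Q ->
  (\int[mu]_(x in `[0%R, t]) (expR (- (t - x) * l) * (P * x `^ (- b) + Q))%:E
    <= (P * (t `^ (- b) / l / (1 - b)) + Q / l)%:E)%E.
Proof.
move=> b0 b1 l0 t0 P0 Q0.
have mp q : measurable_fun setT (fun x : R => x `^ q) by exact: measurable_powR.
have mh := measurable_heat_time l t.
have mk q : measurable_fun setT (fun x : R => expR (- (t - x) * l) * x `^ (- q)).
  exact: measurable_funM.
have k0 q x : 0 <= expR (- (t - x) * l) * x `^ (- q).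
  by rewrite mulr_ge0 ?expR_ge0 ?powR_ge0.
rewrite -integral_itv_obnd_cbnd; last first.
  apply/measurable_EFinP/measurable_funTS; apply: measurable_funM => //.
  by apply: measurable_funD => //; exact: measurable_funM.
(* Writing Q as Q x^0 makes both terms instances of the same heat estimate, with exponents b and
   0. *)
rewrite (@eq_integral _ (measurableTypeR R) R mu _ (fun x : R =>
  (P%:E * (expR (- (t - x) * l) * x `^ (- b))%:E +
   Q%:E * (expR (- (t - x) * l) * x `^ (- 0))%:E)%E)); last first.
  move=> x _; rewrite -!EFinM -EFinD oppr0 powRr0; congr EFin; ring.
have mE r q : measurable_fun (`]0, t]%classic : set R)
    (fun x : R => (r%:E * (expR (- (t - x) * l) * x `^ (- q))%:E)%E).
  by apply/measurable_EFinP/measurable_funTS; exact: measurable_funM.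
rewrite ge0_integralD//; try exact: mE; try by move=> x _; rewrite mule_ge0// lee_fin.
rewrite !ge0_integralZl//; try (by rewrite lee_fin); try by move=> x _; rewrite lee_fin.
- rewrite EFinD !EFinM; apply: leeD; rewrite lee_wpmul2l ?lee_fin//.
    exact: heat_time_integral_le.
  have := @heat_time_integral_le R 0 l t (lexx _) ltr01 l0 t0.
  by rewrite oppr0 addr0 powRr0 divr1 mul1r.
- by apply/measurable_EFinP/measurable_funTS; exact: mk.
- by apply/measurable_EFinP/measurable_funTS; exact: mk.
Qed.

Lemma ae_neq_pos t (S : R -> Prop) :
  (forall x, 0 < x -> x <= t -> S x) -> {ae mu, forall x, `[0, t]%classic x -> S x}.
Proof.
move=> h; exists [set 0]; split => //; first by rewrite lebesgue_measure_set1.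
move=> x /= hx; apply: contrapT => x0; apply: hx; rewrite in_itv/= => /andP[h0 xt].
apply: h => //; rewrite lt_neqAle h0 andbT eq_sym; exact/eqP.
Qed.

(* No measurability in time is assumed on [h], at the price of the factor 6. *)
Lemma cvnorm_duhamel_crude_le h b P Q t xi : 0 <= b -> b < 1 -> 0 <= P -> 0 <= Q ->
  0 < t -> xi != 0 ->
  (forall s, 0 < s -> s <= t -> cvnorm (h s xi) <= P * s `^ (- b) + Q) ->
  cvnorm (duhamel h t xi) <=
    6 * (P * (t `^ (- b) / enorm xi ^+ 2 / (1 - b)) + Q / enorm xi ^+ 2).
Proof.
move=> b0 b1 P0 Q0 t0 xi0 hPQ; apply: le_trans (cvnorm_le _) _.
have l0 : 0 < enorm xi ^+ 2 by rewrite exprn_gt0// enorm_gt0.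
set G := P * _ + _.
apply: (@le_trans _ _ (\sum_(j < 3) 2 * G)); last first.
  by rewrite sumr_const card_ord -(mulr_natl (2 * G)) mulrA -natrM.
apply: ler_sum => j _; rewrite mxE.
apply: (@cmod_Cintegral_le _ _ _ mu `[0, t]%classic _ _
  (fun x => expR (- (t - x) * enorm xi ^+ 2) * (P * x `^ (- b) + Q))) => //.
- apply: measurable_funTS; apply: measurable_funM; first exact: measurable_heat_time.
  by apply: measurable_funD => //; apply: measurable_funM => //; exact: measurable_powR.
- by move=> x _; rewrite mulr_ge0 ?expR_ge0// addr_ge0// mulr_ge0// powR_ge0.
- apply: ae_neq_pos => s s0 st; apply: le_trans (cmod_le_cvnorm _ _) _.
  rewrite cvnormZ cmod_heat ler_wpM2l ?expR_ge0//.
  exact: le_trans (cvnorm_leray _ _) (hPQ _ s0 st).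
- exact: heat_time_integral_cc_le.
Qed.

(** At fixed xi the time integral of the heat kernel gains |xi|^(-2), which turns |xi|^(2 - a) and 1
    back into the two powers of the hypothesis. *)
Lemma cvnorm_Bhat_le a b : 2 <= a -> a < 3 -> 0 <= b -> b < 1 ->
  exists2 C : R, 0 <= C &
  forall (U : R -> space R -> 'cV[R[i]]_3) (P Q M : R),
  0 <= P -> 0 <= Q -> 0 <= M ->
  (forall s, 0 < s -> {ae leb3 R, forall z, cvnorm (U s z) <=
     P * (s `^ (- b) * enorm z `^ (- a)) + Q * enorm z `^ (- 2)}) ->
  (forall s, 0 < s -> {ae leb3 R, forall z, cvnorm (U s z) <= M * enorm z `^ (- 2)}) ->
  forall t xi, 0 < t -> xi != 0 ->
  cvnorm (Bhat U U t xi) <=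
    C * M * (P * (t `^ (- b) * enorm xi `^ (- a)) + Q * enorm xi `^ (- 2)).
Proof.
move=> a2 a3 b0 b1; have [C C0 HC] := @cvnorm_div_tensor_hat_le R a a2 a3.
have b1' : 0 < 1 - b by rewrite subr_gt0.
(* Only the P term produces 1 / (1 - b); as this is at least 1, it can multiply both terms. *)
have K1 : 1 <= (1 - b)^-1 by rewrite invf_ge1//; lra.
exists (6 * C / (1 - b)); first by rewrite divr_ge0 ?mulr_ge0// ltW.
move=> U P Q M P0 Q0 M0 UPQ UM t xi t0 xi0; rewrite /Bhat cvnormN.
have e0 : 0 < enorm xi by rewrite enorm_gt0.
set e := enorm xi in e0 *.
have CM0 : 0 <= C * M by rewrite mulr_ge0.
have h0 : 0 <= P * e `^ (2 - a) by rewrite mulr_ge0 ?powR_ge0.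
apply: (le_trans (@cvnorm_duhamel_crude_le _ b (C * M * (P * e `^ (2 - a))) (C * M * Q)
  t xi b0 b1 _ _ t0 xi0 _)).
- by rewrite mulr_ge0.
- by rewrite mulr_ge0.
- move=> s s0 _; have s'0 : 0 <= P * s `^ (- b) by rewrite mulr_ge0 ?powR_ge0.
  have UPQ' : {ae leb3 R, forall z, cvnorm (U s z) <=
      P * s `^ (- b) * enorm z `^ (- a) + Q * enorm z `^ (- 2)}.
    by apply: ae_imply (UPQ s s0) _ => z; rewrite mulrA.
  apply: le_trans (HC (U s) _ _ _ s'0 Q0 M0 UPQ' (UM s s0) xi xi0) _.
  by rewrite le_eqVlt; apply/orP; left; apply/eqP; rewrite -/e; ring.
- rewrite -/e.
  have -> : e `^ (- a) = e `^ (2 - a) / e ^+ 2.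
    rewrite -powR_mulrn ?(ltW e0)// -powRB ?(gt_eqF e0) ?implybT//.
    by congr (_ `^ _); ring.
  have -> : e `^ (- 2) = (e ^+ 2)^-1 by rewrite powR_invn ?ltW.
  set q := (e ^+ 2)^-1; set p := e `^ (2 - a); set s := t `^ (- b).
  set k := (1 - b)^-1 in K1 *.
  have q0 : 0 <= q by rewrite invr_ge0 exprn_ge0// ltW.
  have Qq : 0 <= 6 * C * M * Q * q by rewrite !mulr_ge0.
  by nra.
Qed.

Lemma measurable_cvnorm d (T : measurableType d) (D : set T) (h : T -> 'cV[R[i]]_3) :
  (forall j, Cmeasurable D (fun y => h y j 0)) ->
  measurable_fun D (fun y => cvnorm (h y)).
Proof.
move=> mh; rewrite (_ : (fun _ => _) = (fun y =>
    (\sum_(j < 3) (complex.Re (h y j 0) ^+ 2 + complex.Im (h y j 0) ^+ 2)) `^ 2^-1)).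
  apply: (measurableT_comp (@measurable_powR R _)).
  apply: measurable_sum => j; have [m1 m2] := mh j.
  by apply: measurable_funD; exact: measurable_funX.
apply/funext => y; rewrite powR12_sqrt; last first.
  by apply: sumr_ge0 => j _; rewrite addr_ge0// sqr_ge0.
by congr Num.sqrt; apply: eq_bigr => j _; rewrite sqr_cmod.
Qed.

Lemma measurable_time_ge0 :
  measurable [set p : measurableTypeR R * mspace R | (0 : R) <= p.1].
Proof.
rewrite (_ : mkset _ = (`[0, +oo[%classic : set (measurableTypeR R)) `*` setT).
  by apply: measurableX.
by apply/seteqP; split => p /=; rewrite in_itv/= andbT => // -[].
Qed.

(** The set where the bound fails is measurable in (s, xi) and its section at each time is null, so
    almost every frequency sees it only at a null set of times. *)
Lemma spacetime_ae (g : R -> space R -> 'cV[R[i]]_3) (G : R -> space R -> R) t :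
  (forall j, Cmeasurable [set p : measurableTypeR R * mspace R | (0 : R) <= p.1]
               (fun p => g p.1 p.2 j 0)) ->
  measurable_fun setT (fun p : measurableTypeR R * mspace R => G p.1 p.2 : R) ->
  (forall s, 0 < s -> {ae leb3 R, forall xi, cvnorm (g s xi) <= G s xi}) ->
  {ae leb3 R, forall xi, {ae mu, forall s, `[0, t]%classic s -> cvnorm (g s xi) <= G s xi}}.
Proof.
move=> mg mG gG.
pose A : set (measurableTypeR R * mspace R) :=
  [set p | (0 : R) < p.1] `&` [set p | G p.1 p.2 < cvnorm (g p.1 p.2)].
have m0 : measurable [set p : measurableTypeR R * mspace R | (0 : R) < p.1].
  rewrite (_ : mkset _ = (`]0, +oo[%classic : set (measurableTypeR R)) `*` setT).
    by apply: measurableX.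
  by apply/seteqP; split => p /=; rewrite in_itv/= andbT => // -[].
have m0' := measurable_time_ge0.
have mA : measurable A.
  apply: (@measurable_fun_ltr _ _ R _ (fun p => G p.1 p.2) (fun p => cvnorm (g p.1 p.2))) => //.
    exact: measurable_funTS.
  apply: measurable_cvnorm => j; have [h1 h2] := mg j; split.
    by apply: (measurable_funS m0' _ h1) => p /=; exact: ltW.
  by apply: (measurable_funS m0' _ h2) => p /=; exact: ltW.
have A0 s : @leb3_fun R (xsection A s) = 0%E.
  have [s0|s0] := ltP 0 s; last first.
    rewrite (_ : xsection A s = set0) ?measure0//; apply/seteqP; split => // xi.
    by rewrite /xsection/= inE => -[/= h]; rewrite ltNge s0 in h.
  have [N [mN N0 hN]] := gG s s0.
  apply: (subset_measure0 _ mN) => //; first exact: measurable_xsection.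
  move=> xi; rewrite /xsection/= inE => -[/= _ h]; apply: hN => /=.
  by apply/negP; rewrite -ltNge.
apply: (ae_imply (@ae_null_sections R _ _ _ _ mu (@leb3_fun R) A mA A0)) => xi hxi.
(* Time 0 is added to the exceptional set because the bound is given for s > 0 only. *)
exists (ysection A xi `|` [set 0]); split.
- by apply: measurableU => //; exact: measurable_ysection.
- rewrite measureU0//; first exact: measurable_ysection.
  exact: lebesgue_measure_set1.
- move=> s /= /not_implyP[]; rewrite in_itv/= => /andP[s0 _] /negP h.
  have [->|sN0] := eqVneq s 0; [by right|left].
  rewrite /ysection/= inE; split => /=; first by rewrite lt_neqAle eq_sym sN0.
  by rewrite ltNge.
Qed.

Lemma measurable_Csum d (T : measurableType d) (D : set T)
    (r : 'I_3 -> T -> R) (f : 'I_3 -> T -> R[i]) :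
  (forall j, measurable_fun D (r j)) -> (forall j, Cmeasurable D (f j)) ->
  Cmeasurable D (fun y => \sum_(j < 3) (((r j y)%:C)%C * f j y)).
Proof.
move=> mr mf; split.
  rewrite (_ : (fun _ => _) = (fun y => \sum_(j < 3) (r j y * complex.Re (f j y)))).
    by apply: measurable_sum => j; apply: measurable_funM => //; have [] := mf j.
  apply/funext => y; rewrite (big_morph _ ReD (erefl _)).
  by apply: eq_bigr => j _; rewrite ReM_real.
rewrite (_ : (fun _ => _) = (fun y => \sum_(j < 3) (r j y * complex.Im (f j y)))).
  by apply: measurable_sum => j; apply: measurable_funM => //; have [] := mf j.
apply/funext => y; rewrite (big_morph _ ImD (erefl _)).
by apply: eq_bigr => j _; rewrite ImM_real.
Qed.

(** The lossless counterpart for the force: contraction by the projector, Minkowski's inequality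
    with constant 1, and 1 / (1 - b) from the time integral alone. *)
Lemma cvnorm_duhamel_le (g : R -> space R -> 'cV[R[i]]_3) b c N t :
  0 <= b -> b < 1 -> 0 <= N -> 0 < t ->
  (forall j, Cmeasurable [set p : measurableTypeR R * mspace R | (0 : R) <= p.1]
               (fun p => g p.1 p.2 j 0)) ->
  (forall s, 0 < s -> {ae leb3 R, forall xi,
     cvnorm (g s xi) <= N * (s `^ (- b) * enorm xi `^ c)}) ->
  {ae leb3 R, forall xi, cvnorm (duhamel g t xi) <=
     N / (1 - b) * (t `^ (- b) * enorm xi `^ (c - 2))}.
Proof.
move=> b0 b1 N0 t0 mg gN.
have mG : measurable_fun setT (fun p : measurableTypeR R * mspace R =>
    N * ((p.1 : R) `^ (- b) * enorm (p.2 : space R) `^ c) : R).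
  apply: measurable_funM => //; apply: measurable_funM;
    apply: (measurableT_comp (@measurable_powR R _)).
    exact: measurable_fst.
  by apply: (measurableT_comp measurable_enorm0); exact: measurable_snd.
have := @spacetime_ae g (fun s xi => N * (s `^ (- b) * enorm xi `^ c)) t mg mG gN.
move=> hae; apply: (ae_imply2 ae_neq0 hae) => xi xi0 hxi.
have e0 : 0 < enorm xi by rewrite enorm_gt0.
have l0 : 0 < enorm xi ^+ 2 by rewrite exprn_gt0.
apply: (@cvnorm_Cintegral_le _ _ _ mu `[0, t]%classic _
  (fun s => heat (t - s) xi *: (leray xi *m g s xi))
  (fun s => expR (- (t - s) * enorm xi ^+ 2) * ((N * enorm xi `^ c) * s `^ (- b) + 0))) => //.
- move=> j.
  have mgk k : Cmeasurable `[0, t]%classic (fun s => g s xi k 0).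
    have mp : measurable_fun (`[0, t]%classic : set (measurableTypeR R))
        (fun s => (s, xi) : measurableTypeR R * mspace R).
      by apply: measurable_funTS; apply/measurable_fun_pairP; split;
        [exact: measurable_id|exact: measurable_cst].
    have sub : [set ((s, xi) : measurableTypeR R * mspace R) | s in `[0, t]%classic]
        `<=` [set p | (0 : R) <= p.1].
      by move=> _ [s /= + <-] /=; rewrite in_itv/= => /andP[].
    have [h1 h2] := mg k; split.
      exact: (measurable_comp measurable_time_ge0 sub h1 mp).
    exact: (measurable_comp measurable_time_ge0 sub h2 mp).
  rewrite (_ : (fun _ => _) = (fun s : R => \sum_(k < 3) (((expR (- (t - s) *
     enorm xi ^+ 2) * ((j == k)%:R - coord xi j * coord xi k / enorm xi ^+ 2))%:C)%C
     * g s xi k 0))); last first.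
    apply/funext => s; rewrite !mxE mulr_sumr; apply: eq_bigr => k _.
    by rewrite mxE mulrA -rmorphM.
  apply: measurable_Csum => // k; apply: measurable_funTS; apply: measurable_funM => //.
  exact: measurable_heat_time.
- apply: measurable_funTS; apply: measurable_funM; first exact: measurable_heat_time.
  by apply: measurable_funD => //; apply: measurable_funM => //; exact: measurable_powR.
- by move=> x _; rewrite addr0 !mulr_ge0 ?expR_ge0 ?powR_ge0.
- apply: (ae_imply hxi) => s hs /hs h1; rewrite cvnormZ cmod_heat ler_wpM2l ?expR_ge0//.
  apply: le_trans (cvnorm_leray _ _) _; apply: le_trans h1 _.
  by rewrite addr0 -mulrA [X in _ * X]mulrC.
- apply: le_trans (heat_time_integral_cc_le b0 b1 l0 t0 _ _) _ => //.
    by rewrite mulr_ge0 ?powR_ge0.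
  rewrite lee_fin mul0r addr0.
  rewrite powRB ?(gt_eqF e0) ?implybT// (_ : enorm xi `^ 2 = enorm xi ^+ 2); last first.
    by rewrite -powR_mulrn// ltW.
  by rewrite le_eqVlt; apply/orP; left; apply/eqP; ring.
Qed.

End Duhamel.

(** * Decay of solutions *)

Section Norms.
Context {R : realType}.
Implicit Types (c N : R) (v : vfunctional R) (u : R -> vfunctional R).

Lemma PMnorm_leP c v N : (PMnorm c v <= N%:E)%E <->
  {ae leb3 R, forall xi, cvnorm (vhat v xi) <= N * enorm xi `^ (- c)}.
Proof.
have E (xi : space R) : xi != 0 -> (enorm xi `^ c * cvnorm (vhat v xi) <= N) =
    (cvnorm (vhat v xi) <= N * enorm xi `^ (- c)).
  by move=> xi0; rewrite powRN ler_pdivlMr ?powR_gt0 ?enorm_gt0// mulrC.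
split.
  move=> /ess_supP h; apply: (ae_imply2 ae_neq0 h) => xi xi0.
  by rewrite lee_fin E.
move=> h; apply/ess_supP; apply: (ae_imply2 ae_neq0 h) => xi xi0.
by rewrite lee_fin E.
Qed.

Lemma PMnorm_ge0 c v : (0 <= PMnorm c v)%E.
Proof.
apply: ess_sup_gee; first exact: leb3_setT_gt0.
by apply: nearW => xi; rewrite lee_fin mulr_ge0 ?powR_ge0 ?cvnorm_ge0.
Qed.

Lemma PMnorm_le_Cwnorm c u t : 0 <= t -> (PMnorm c (u t) <= Cwnorm c u)%E.
Proof. by move=> t0; apply: ereal_sup_ubound; exists t. Qed.

Lemma weighted_sup_leP b c u N : (weighted_sup b c u <= N%:E)%E <->
  (forall t, 0 < t -> (PMnorm c (u t) <= (N * t `^ (- b))%:E)%E).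
Proof.
have E t : 0 < t -> ((t `^ b)%:E * PMnorm c (u t) <= N%:E)%E =
    (PMnorm c (u t) <= (N * t `^ (- b))%:E)%E.
  by move=> t0; rewrite powRN mulrC EFinM lee_pdivlMl ?powR_gt0.
split => [h t t0|h].
  by rewrite -E//; apply: le_trans h; apply: ereal_sup_ubound; exists t.
by apply: ge_ereal_sup => _ [t /= t0 <-]; rewrite E// h.
Qed.

Lemma weighted_sup_ge0 b c u : (0 <= weighted_sup b c u)%E.
Proof.
have h : ((1 `^ b)%R%:E * PMnorm c (u 1%R) <= weighted_sup b c u)%E.
  by apply: ereal_sup_ubound; exists 1 => /=.
by apply: le_trans h; rewrite mule_ge0 ?PMnorm_ge0// lee_fin powR_ge0.
Qed.

Lemma Cwnorm_ge0 c u : (0 <= Cwnorm c u)%E.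
Proof. by apply: le_trans (PMnorm_ge0 c (u 0)) (PMnorm_le_Cwnorm _ _ _). Qed.

Lemma adde3_lt_fin (x y z : \bar R) (e : R) : (0 <= x)%E -> (0 <= y)%E ->
  (0 <= z)%E -> (x + y + z < e%:E)%E ->
  exists p r : R, [/\ x = p%:E, z = r%:E, 0 <= p, 0 <= r & p + r < e].
Proof.
case: x => [p| |]//; case: y => [q| |]//; case: z => [r| |]//.
rewrite -!EFinD !lee_fin lte_fin => p0 q0 r0 h; exists p, r; split => //; lra.
Qed.

End Norms.

(** * The bootstrap and the choice of [eps] *)

Section Bootstrap.
Context {R : realType}.

(** Equivalent to s^b <= e^s: the left side is at most 1 for s <= 1 and at most s beyond. It trades
    the decay of the heat factor for a power without losing a constant. *)
Lemma expRN_le_powR (s b : R) : 0 < s -> 0 <= b -> b <= 1 -> expR (- s) <= s `^ (- b).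
Proof.
move=> s0 b0 b1; rewrite expRN powRN lef_pV2 ?posrE ?expR_gt0 ?powR_gt0//.
have [s1|s1] := leP s 1.
  apply: (@le_trans _ _ 1); last by rewrite -expR0 ler_expR ltW.
  by rewrite -(powRr0 s) ger_powR// s0.
apply: (@le_trans _ _ s); first by rewrite ler1_powR// ltW.
by apply: le_trans (expR_ge1Dx s); lra.
Qed.

Lemma le_of_geometric_error (x y c q : R) : 0 <= q -> q < 1 ->
  (forall n, x <= y + c * q ^+ n) -> x <= y.
Proof.
move=> q0 q1 h.
have cv : (fun n => y + c * q ^+ n) @ \oo --> y + c * 0.
  apply: cvgD; first exact: cvg_cst.
  by apply: cvgM; [exact: cvg_cst|apply: cvg_expr]; rewrite ger0_norm.
rewrite -(addr0 y) -(mulr0 c) -(cvg_lim _ cv)//.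
apply: limr_ge; first by apply/cvg_ex; eexists; exact: cv.
exact: nearW.
Qed.

(** The condition (N0 + N2) / (1 - b) + C M M <= M lets the coefficient of phi reproduce itself,
    while C M < 1 contracts that of |xi|^(-2). *)
Lemma solution_decay (a b C N0 N2 M : R) (U Fh : R -> space R -> 'cV[R[i]]_3)
    (v0 : space R -> 'cV[R[i]]_3) :
  b = a / 2 - 1 -> 2 <= a -> a < 3 -> 0 <= N0 -> 0 <= N2 -> 0 <= M -> 0 <= C ->
  C * M < 1 -> (N0 + N2) / (1 - b) + C * M * M <= M ->
  (forall (V : R -> space R -> 'cV[R[i]]_3) (P Q : R), 0 <= P -> 0 <= Q ->
    (forall s, 0 < s -> {ae leb3 R, forall z, cvnorm (V s z) <=
       P * (s `^ (- b) * enorm z `^ (- a)) + Q * enorm z `^ (- 2)}) ->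
    (forall s, 0 < s -> {ae leb3 R, forall z, cvnorm (V s z) <= M * enorm z `^ (- 2)}) ->
    forall t xi, 0 < t -> xi != 0 ->
    cvnorm (Bhat V V t xi) <=
      C * M * (P * (t `^ (- b) * enorm xi `^ (- a)) + Q * enorm xi `^ (- 2))) ->
  (forall j, Cmeasurable [set p : measurableTypeR R * mspace R | (0 : R) <= p.1]
               (fun p => Fh p.1 p.2 j 0)) ->
  {ae leb3 R, forall xi, cvnorm (v0 xi) <= N0 * enorm xi `^ (- 2)} ->
  (forall s, 0 < s -> {ae leb3 R, forall xi,
     cvnorm (Fh s xi) <= N2 * (s `^ (- b) * enorm xi `^ (- (a - 2)))}) ->
  (forall s, 0 < s -> {ae leb3 R, forall xi, cvnorm (U s xi) <= M * enorm xi `^ (- 2)}) ->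
  (forall s, 0 < s -> {ae leb3 R, forall xi,
     U s xi = heat s xi *: v0 xi + Bhat U U s xi + duhamel Fh s xi}) ->
  forall t, 0 < t -> {ae leb3 R, forall xi,
    cvnorm (U t xi) <= M * (t `^ (- b) * enorm xi `^ (- a))}.
Proof.
move=> bE a2 a3 N00 N20 M0 C0 CM NM HB mF hv0 hF hU hsol.
have b0 : 0 <= b by lra.
have b1 : b < 1 by lra.
have CM0 : 0 <= C * M by rewrite mulr_ge0.
pose phi (s : R) (xi : space R) := s `^ (- b) * enorm xi `^ (- a).
have phi0 s xi : 0 <= phi s xi by rewrite mulr_ge0 ?powR_ge0.
have lin s : 0 < s -> {ae leb3 R, forall xi,
    cvnorm (heat s xi *: v0 xi + duhamel Fh s xi) <= (N0 + N2) / (1 - b) * phi s xi}.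
  move=> s0; have hD := cvnorm_duhamel_le b0 b1 N20 s0 mF hF.
  have h12 := ae_imply2 hv0 hD (fun xi h1 h2 => conj h1 h2).
  apply: (ae_imply2 ae_neq0 h12) => xi xi0 [h1 h2].
  have e0 : 0 < enorm xi by rewrite enorm_gt0.
  apply: le_trans (cvnormD _ _) _.
  rewrite mulrDl mulrDl; apply: lerD; last first.
    by apply: le_trans h2 _; rewrite /phi le_eqVlt; apply/orP; left; apply/eqP;
      congr (_ * (_ * _ `^ _)); ring.
  rewrite cvnormZ cmod_heat.
  have hh : expR (- s * enorm xi ^+ 2) <= (s * enorm xi ^+ 2) `^ (- b).
    rewrite mulNr expRN_le_powR// ?(ltW b1)//.
    by rewrite mulr_gt0// exprn_gt0.
  (* The exponents match because 2 b + 2 = a. *)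
  have -> : N0 / (1 - b) * phi s xi =
     (s * enorm xi ^+ 2) `^ (- b) * (N0 * enorm xi `^ (- 2)) / (1 - b).
    rewrite powRM ?exprn_ge0 ?(ltW s0) ?(ltW e0)// -(powR_mulrn 2 (ltW e0)) -powRrM.
    rewrite /phi (_ : - a = 2%:R * - b - 2); last by rewrite bE; field.
    by rewrite powRD ?(gt_eqF e0) ?implybT//; ring.
  apply: (@le_trans _ _ ((s * enorm xi ^+ 2) `^ (- b) * (N0 * enorm xi `^ (- 2)))).
    by apply: ler_pM; rewrite ?expR_ge0 ?cvnorm_ge0.
  rewrite ler_peMr ?mulr_ge0 ?powR_ge0//.
  by rewrite invf_ge1//; lra.
have step n s : 0 < s -> {ae leb3 R, forall xi,
    cvnorm (U s xi) <= M * phi s xi + M * (C * M) ^+ n * enorm xi `^ (- 2)}.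
  elim: n s => [|n IH] s s0.
    apply: ae_imply (hU s s0) _ => xi h; apply: le_trans h _.
    by rewrite expr0 mulr1 lerDr mulr_ge0.
  have Q0 : 0 <= M * (C * M) ^+ n by rewrite mulr_ge0// exprn_ge0.
  have hB := HB U M _ M0 Q0 IH hU s.
  have h12 := ae_imply2 (lin s s0) (hsol s s0) (fun xi h1 h2 => conj h1 h2).
  apply: (ae_imply2 ae_neq0 h12) => xi xi0 [h1 ->].
  rewrite addrAC; apply: le_trans (cvnormD _ _) _.
  apply: le_trans (lerD h1 (hB xi s0 xi0)) _; rewrite -/(phi s xi) mulrDr.
  rewrite addrA; apply: lerD.
    by rewrite mulrA -mulrDl ler_wpM2r.
  by rewrite exprS le_eqVlt; apply/orP; left; apply/eqP; ring.
(* The countably many null sets are merged before n tends to infinity at a fixed frequency. *)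
move=> t t0; have hall : {ae leb3 R, forall xi, forall n,
    cvnorm (U t xi) <= M * phi t xi + M * (C * M) ^+ n * enorm xi `^ (- 2)}.
  by apply/ae_foralln => n; exact: step.
apply: ae_imply hall _ => xi h.
apply: (@le_of_geometric_error _ _ (M * enorm xi `^ (- 2)) (C * M)) => // n.
by apply: le_trans (h n) _; rewrite le_eqVlt; apply/orP; left; apply/eqP; rewrite /phi; ring.
Qed.

End Bootstrap.

Theorem theorem7p1 (R : realType) (eta : R) (eta_gt0 : 0 < eta)
    (eta_bound : B_bound eta) (a : R) (a_ge2 : 2 <= a) (a_lt3 : a < 3) :
  exists eps : R, 0 < eps /\ eps < 1 / (4 * eta) /\
    forall (u0 : vfunctional R) (F : R -> vfunctional R),
      PM 2 u0 -> Cw 0 F -> (forall t, 0 < t -> PM (a - 2) (F t)) ->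
      (PMnorm 2 u0 + Cwnorm 0 F + weighted_sup (a / 2 - 1) (a - 2) F
         < eps%:E)%E ->
      forall u : R -> vfunctional R,
        NS_solution u0 F u -> (Cwnorm 2 u <= (2 * eps)%:E)%E ->
        (forall t, 0 < t -> PM a (u t)) /\
        (weighted_sup (a / 2 - 1) a u <= (2 * eps)%:E)%E.
Proof.
have [b bE] : exists b, b = a / 2 - 1 by exists (a / 2 - 1).
rewrite -bE.
have b0 : 0 <= b by lra.
have b1 : b < 1 by lra.
have [C C0 HC] := cvnorm_Bhat_le a_ge2 a_lt3 b0 b1.
have [K KE] : exists K, K = (1 - b)^-1 by exists (1 - b)^-1.
have K1 : 1 <= K by rewrite KE invf_ge1; lra.
have K2 : K < 2 by rewrite KE -[2]invrK ltf_pV2 ?posrE ?invr_gt0//; lra.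
(* Multiplied by eps, the second condition reads K eps + C (2 eps)^2 <= 2 eps, which closes the
   bootstrap; with K >= 1 it also gives C (2 eps) <= 1/2. The denominator 4 C + 1 allows C = 0, and
   8 eta makes the last bound strict. *)
have [eps [eps0 epsC epsE]] : exists eps,
    [/\ 0 < eps, 4 * C * eps <= 2 - K & eps < 1 / (4 * eta)].
  have C41 : 0 < 4 * C + 1 by lra.
  exists (Num.min ((2 - K) / (4 * C + 1)) (1 / (8 * eta))).
  set e := Num.min _ _.
  have e1 : e <= (2 - K) / (4 * C + 1) by rewrite ge_min lexx.
  have e2 : e <= 1 / (8 * eta) by rewrite ge_min lexx orbT.
  have e0 : 0 < e by rewrite lt_min divr_gt0 ?subr_gt0//= divr_gt0// mulr_gt0.
  split.
  - exact: e0.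
  - by move: e1 e0; move: (e) => {e2} e'; rewrite ler_pdivlMr//; lra.
  - apply: (le_lt_trans e2).
    by rewrite !div1r ltf_pV2 ?posrE ?mulr_gt0// ltr_pM2r//; lra.
exists eps; split; first exact: eps0.
split; first exact: epsE.
move=> u0 F hu0 hF hFa hsum u [hu [U [Fh [[mU eU] [mFh eFh] hsol]]]] hunorm.
have [N0 [N2 [E0 E2 N00 N20 N02]]] := adde3_lt_fin (PMnorm_ge0 _ _) (Cwnorm_ge0 _ _)
  (weighted_sup_ge0 _ _ _) hsum.
have decay t : 0 < t -> {ae leb3 R, forall xi,
    cvnorm (U t xi) <= 2 * eps * (t `^ (- b) * enorm xi `^ (- a))}.
  have M0 : 0 <= 2 * eps by rewrite mulr_ge0// ltW.
  have CM : C * (2 * eps) < 1 by lra.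
  have NM : (N0 + N2) / (1 - b) + C * (2 * eps) * (2 * eps) <= 2 * eps.
    have h1 : (N0 + N2) / (1 - b) <= eps * K.
      by rewrite -KE ler_wpM2r ?(ltW N02)//; apply: le_trans ler01 K1.
    by have h2 := ler_wpM2l (ltW eps0) epsC; lra.
  apply: (@solution_decay R a b C N0 N2 (2 * eps) U Fh (vhat u0) bE a_ge2 a_lt3
    N00 N20 M0 C0 CM NM (fun V P Q P0 Q0 => HC V P Q (2 * eps) P0 Q0 M0) mFh).
  - by apply/PMnorm_leP; rewrite E0.
  - move=> s s0; have h : (weighted_sup b (a - 2) F <= N2%:E)%E by rewrite E2.
    have /PMnorm_leP {}h := (weighted_sup_leP _ _ _ _).1 h s s0.
    by apply: (ae_imply2 (eFh s (ltW s0)) h) => xi ->; rewrite mulrA.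
  - move=> s s0; have /PMnorm_leP h := le_trans (PMnorm_le_Cwnorm 2 u (ltW s0)) hunorm.
    by apply: (ae_imply2 (eU s (ltW s0)) h) => xi ->.
  (* The equation is stated for [vhat (u s)] and the nonlinear term for [U]; they agree almost
     everywhere at each time. *)
  - by move=> s s0; apply: (ae_imply2 (eU s (ltW s0)) (hsol s (ltW s0))) => xi -> ->.
have hnorm t : 0 < t -> (PMnorm a (u t) <= (2 * eps * t `^ (- b))%:E)%E.
  move=> t0; apply/PMnorm_leP.
  by apply: (ae_imply2 (eU t (ltW t0)) (decay t t0)) => xi ->; rewrite mulrA.
split; last by apply/weighted_sup_leP.
move=> t t0; split; last exact: le_lt_trans (hnorm t t0) (ltry _).
by have [hPM _ _] := hu; have [] := hPM t (ltW t0).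
Qed.
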